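(* Let $d\ge 1$ be an integer and let $p,q\in(0,1)$ satisfy $$\beta:=-\log_2(2^d p q)>0,\qquad p>2^{-d},\quad q>2^{-d}.$$ Let $Q_d(p;\cdot)$ and $\widehat Q_d(q;\cdot)$ be two independent discrete fractal percolations with parameters $p$ and $q$ respectively. Then there are constants $0<c\le C<\infty$ depending only on $d,p,q$ such that for all integers $1\le m\le n$ and every nonempty set $A\subset[-2^{n-1},2^{n-1})^d\cap\mathbb Z^d$, $$c\,(2^dp)^m\le\frac{\mathbb P\big((Q_d(p;m)+\widehat Q_d(q;n))\cap A\neq\emptyset\big)}{q^n\,\mathrm{Cap}_\beta(A)}\le C\,(2^dp)^{\max\{m,\ \log_2\mathrm{diam}(A)\}}.$$
   Context: Discrete fractal percolation: fix $d\ge1$ and $p\in[0,1]$. Tile $[-\frac12,\frac12)^d$ naturally by $2^d$ half-open cubes that are translates of $[0,\frac12)^d$; keep each independently with probability $p$, and let $Z_1$ be the collection of kept cubes. Iteratively, divide each cube of $Z_k$ into $2^d$ half-open cubes that are translates of $[0,2^{-k-1})^d$ and keep each independently with probability $p$ to obtain $Z_{k+1}$. Then $Q_d(p;k):=\big(\bigcup_{Q\in Z_k}2^kQ\big)\cap\mathbb Z^d$, a random subset of $[-2^{k-1},2^{k-1})^d\cap\mathbb Z^d$. $|\cdot|$ is the Euclidean norm, $\mathrm{diam}$ the Euclidean diameter, and $\log_2 0=-\infty$ (so the maximum is $m$ when $A$ is a single point). For a nonempty finite set $A\subset\mathbb Z^d$ and $0<\beta<d$, $$\mathrm{Cap}_\beta(A):=\Big(\inf_\mu\sum_{x,y\in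 A}\mu(x)\mu(y)\,(|x-y|\vee1)^{-\beta}\Big)^{-1},$$ the infimum over probability measures $\mu$ on $A$. $A+B=\{a+b:a\in A,b\in B\}$ (empty if $A$ or $B$ is empty). *)

(* Defs.v *)
From HB Require Import structures.
From mathcomp Require Import all_boot all_order all_algebra finmap.
From mathcomp Require Import all_classical all_reals all_analysis.

Set Implicit Arguments.
Unset Strict Implicit.
Unset Printing Implicit Defensive.

Import Order.TTheory GRing.Theory Num.Theory.
Import numFieldNormedType.Exports.

Local Open Scope classical_set_scope.
Local Open Scope ring_scope.

(* A dyadic subcube of [-1/2, 1/2)^d of side 2^-k is addressed by the sequence
   of the k binary subdivision choices leading to it, the FINEST choice coming
   first: [e :: a] is the child of the cube [a] in the direction of the vertex
   [e] of {0,1}^d, and [::] is [-1/2, 1/2)^d itself. *)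
Definition address (d : nat) := seq {ffun 'I_d -> bool}.

Section Cubes.
Variables (R : realType) (d : nat).

Fixpoint corner (a : address d) : 'rV[R]_d :=
  if a is e :: b
  then corner b + 2 ^- (size a) *: \row_i ((e i)%:R : R)
  else const_mx (- 2^-1).

Definition cube (a : address d) : set 'rV[R]_d :=
  [set x | forall i, corner a 0 i <= x 0 i < corner a 0 i + 2 ^- (size a)].

End Cubes.

Section Percolation.
Variables (R : realType) (d : nat) (dT : measure_display).
Variables (T : measurableType dT) (P : probability T R).

(* [keep a] is the event that the cube [a] is kept when its parent is divided;
   the initial cube [::] is never subject to removal. *)
Definition percolation_coins (p : R) (keep : address d -> set T) : Prop :=
  [/\ forall a, a != [::] -> measurable (keep a),
      forall a, a != [::] -> P (keep a) = p%:E
    & forall s : seq (address d), uniq s -> [::] \notin s ->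
        P (\bigcap_(a in [set` s]) keep a) = (\prod_(a <- s) P (keep a))%E].

Fixpoint Z (keep : address d -> set T) (k : nat) (t : T) : set (address d) :=
  if k is j.+1
  then [set a | exists e b, [/\ a = e :: b, Z keep j t b & keep a t]]
  else [set [::]].

Definition Q (keep : address d -> set T) (k : nat) (t : T) : set 'rV[int]_d :=
  [set z | exists2 a, Z keep k t a &
           exists2 x, cube a x & map_mx intr z = 2 ^+ k *: (x : 'rV[R]_d)].

Definition process_events (X : nat -> T -> set 'rV[int]_d) : set (set T) :=
  [set E | exists k z, E = [set t | X k t z]].

Definition independent_processes (X Y : nat -> T -> set 'rV[int]_d) : Prop :=
  forall E F, <<s process_events X >> E -> <<s process_events Y >> F ->
    P (E `&` F) = (P E * P F)%E.

End Percolation.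

(* [A `+` B] is symmetric difference in MathComp-Analysis, hence this. *)
Definition sumset (V : zmodType) (A B : set V) : set V :=
  [set a + b | a in A & b in B].

Definition box (d n : nat) : set 'rV[int]_d :=
  [set z | forall i, - 2 ^+ n.-1 <= z 0 i < 2 ^+ n.-1].

Section Capacity.
Variables (R : realType) (d : nat).

(* The norm provided by the library on row vectors is the sup norm. *)
Definition enorm (z : 'rV[int]_d) : R :=
  Num.sqrt (\sum_i ((z 0 i)%:~R) ^+ 2).

Definition diam (A : {fset 'rV[int]_d}) : R :=
  \big[Num.max/0]_(x <- A) \big[Num.max/0]_(y <- A) enorm (x - y).

Definition energy (beta : R) (A : {fset 'rV[int]_d}) (mu : 'rV[int]_d -> R) : R :=
  \sum_(x <- A) \sum_(y <- A)
    mu x * mu y * (Num.max (enorm (x - y)) 1) `^ (- beta).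

Definition prob_on (A : {fset 'rV[int]_d}) (mu : 'rV[int]_d -> R) : Prop :=
  (forall x, x \in A -> 0 <= mu x) /\ \sum_(x <- A) mu x = 1.

Definition Cap (beta : R) (A : {fset 'rV[int]_d}) : R :=
  (inf [set energy beta A mu | mu in prob_on A])^-1.

End Capacity.

Definition log2 (R : realType) (x : R) : R := ln x / ln 2.

(* [ln 0 = 0] in the library, whereas log2 0 = -oo is wanted. *)
Definition log2e (R : realType) (x : R) : \bar R :=
  if x == 0 then -oo%E else (log2 x)%:E.

(* Main.v *)
Require Import Defs.
From HB Require Import structures.
From mathcomp Require Import all_boot all_order all_algebra finmap.
From mathcomp Require Import all_classical all_reals all_analysis.
From mathcomp Require Import zify ring lra.

Set Implicit Arguments.
Unset Strict Implicit.
Unset Printing Implicit Defensive.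

Import Order.TTheory GRing.Theory Num.Theory.
Import numFieldNormedType.Exports.

Local Open Scope classical_set_scope.
Local Open Scope ring_scope.

(** A point of the percolation set of depth [k] is a leaf of the [2 ^ d]-ary tree
    of depth [k] all of whose edges are open, so the hitting event says that some
    pair (x, y) of leaves with [x + y \in A] survives in both trees. Put
    [rho = 2 ^ d * p * q = 2 ^ (- beta)]; up to constants the kernel of the energy
    is [rho ^ lev], where [2 ^ lev] is the dyadic size of a displacement.

    The probability space enters only through the laws of the two sets of
    surviving leaves: by [hit_law] the hitting probability is an iterated average
    over finitely many independent coins.

    Lower bound ([hits_lower]). Given a probability measure [mu] on [A], count the
    surviving pairs (x, y) above [A] with weight [mu (x + y)]. Every point of the
    box is a sum in at least [2 ^ (d * (m - 1))] ways, which gives the first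
    moment. In the second moment two pairs contribute [p ^ lev * q ^ lev] times
    the probability [p ^ m * q ^ n] of one pair, and the sum over all pairs with a
    given sum is a convolution, bounded by a multiple of [rho ^ lev]
    ([convolution_le]; this uses [2 ^ d * p > 1], [2 ^ d * q > 1] and [rho < 1]).
    So the second moment is at most a multiple of the energy of [mu].

    Upper bound ([hits_upper]). Pairs of nodes form a tree of depth [n], in which
    the first [n - m] generations split in the second component only. Events below
    different children share coins, hence are dependent, but they are increasing:
    by Harris' inequality their union is at most as likely as for independent
    events. This suffices for the recursion known from percolation on trees:
    [admissible_node] yields a measure on the pairs above [A] whose mass dominates
    the hitting probability and whose tree energy is at most a constant times
    [p ^ m * q ^ n] times its mass. Addition maps it to a measure on [A]. A cube of
    side [2 ^ k] in the target is fed by a number of nodes of height [k <= m] that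
    is of order [2 ^ (d * (m - k))], so by the Schur test the energy of the image
    for the kernel [rho ^ lev] is controlled by the tree energy, whose kernel at
    height [k] is of order [(p * q) ^ k] ([energy_form]). At heights between [m]
    and the level of the diameter of [A] no such spreading takes place, and this
    is where the maximum in the exponent of the upper bound comes from. *)

(** * Independent coins and Harris' inequality *)

Section Coins.
Variables (R : realFieldType) (K : eqType) (w : K -> R).
Hypothesis w01 : forall a, 0 <= w a <= 1.
Implicit Types (o : K -> bool) (s : seq K) (f g : (K -> bool) -> R).

Definition upd o (a : K) (b : bool) : K -> bool :=
  fun c => if c == a then b else o c.

(** Coins are averaged one at a time, so that no product space has to be built
    and statements about independent coins become inductions on the list [s];
    [o] supplies the values of the coins that are not in [s]. *)
Fixpoint expect s f o : R :=
  if s is a :: s' then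
    w a * expect s' f (upd o a true) + (1 - w a) * expect s' f (upd o a false)
  else f o.

Lemma w_ge0 a : 0 <= w a. Proof. by case/andP: (w01 a). Qed.
Lemma w_le1 a : w a <= 1. Proof. by case/andP: (w01 a). Qed.
Lemma w_compl_ge0 a : 0 <= 1 - w a. Proof. by rewrite subr_ge0 w_le1. Qed.
Hint Resolve w_ge0 w_le1 w_compl_ge0 : core.

Lemma upd_same o a b : upd o a b a = b.
Proof. by rewrite /upd eqxx. Qed.

Lemma upd_other o a b c : c != a -> upd o a b c = o c.
Proof. by rewrite /upd => /negbTE ->. Qed.

Lemma updC o a b c e : a != c -> upd (upd o a b) c e = upd (upd o c e) a b.
Proof.
move=> ac; apply/funext => x; rewrite /upd.
by case: (eqVneq x c) => // ->; rewrite eq_sym (negbTE ac).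
Qed.

Lemma eq_expect s f g o : f =1 g -> expect s f o = expect s g o.
Proof. by move=> fg; elim: s o => //= a s IH o; rewrite !IH. Qed.

Lemma expectD s f g o :
  expect s (fun o => f o + g o) o = expect s f o + expect s g o.
Proof. by elim: s o => //= a s IH o; rewrite !IH; ring. Qed.

Lemma expectZ s c f o : expect s (fun o => c * f o) o = c * expect s f o.
Proof. by elim: s o => //= a s IH o; rewrite !IH; ring. Qed.

Lemma expect_cst s c o : expect s (fun=> c) o = c.
Proof. by elim: s o => //= a s IH o; rewrite !IH; ring. Qed.

Lemma expect_sum s (I : Type) (r : seq I) (Q : pred I)
    (F : I -> (K -> bool) -> R) o :
  expect s (fun o => \sum_(i <- r | Q i) F i o) o
  = \sum_(i <- r | Q i) expect s (F i) o.
Proof.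
elim: r => [|i r IH].
  rewrite big_nil -[RHS](expect_cst s 0 o); apply: eq_expect => o'.
  by rewrite big_nil.
rewrite big_cons; case: ifP => Qi; rewrite -IH -?expectD.
  by apply: eq_expect => o'; rewrite big_cons Qi.
by apply: eq_expect => o'; rewrite big_cons Qi.
Qed.

Lemma le_expect s f g o :
  (forall o, f o <= g o) -> expect s f o <= expect s g o.
Proof.
by move=> fg; elim: s o => //= a s IH o; rewrite lerD ?ler_wpM2l.
Qed.

Lemma expect_ge0 s f o : (forall o, 0 <= f o) -> 0 <= expect s f o.
Proof. by move=> f0; rewrite -(expect_cst s 0 o) le_expect. Qed.

Lemma expect_cat s1 s2 f o : expect (s1 ++ s2) f o = expect s1 (expect s2 f) o.
Proof. by elim: s1 o => //= a s IH o; rewrite !IH. Qed.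

Definition antitone f := forall o o', (forall a, o a ==> o' a) -> f o' <= f o.

Lemma upd_mono o o' a b : (forall a, o a ==> o' a) ->
  forall c, upd o a b c ==> upd o' a b c.
Proof. by move=> oo' c; rewrite /upd; case: ifP; rewrite ?implybb. Qed.

Lemma expect_antitone s f : antitone f -> antitone (expect s f).
Proof.
move=> Hf; elim: s => //= a s IH o o' oo'.
by rewrite lerD // ler_wpM2l // IH // => c; apply: upd_mono.
Qed.

(** Harris' inequality. After conditioning on the first coin, both conditional
    expectations move in the same direction, so the two-point Chebyshev sum
    inequality reduces the claim to the remaining coins. *)
Lemma harris s f g o : antitone f -> antitone g ->
  expect s f o * expect s g o <= expect s (fun o => f o * g o) o.
Proof.
move=> Hf Hg; elim: s o => //= a s IH o.
set t := upd o a true; set u := upd o a false.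
have ut c : u c ==> t c by rewrite /u /t /upd; case: ifP; rewrite ?implybb.
have Ff := expect_antitone s Hf ut; have Fg := expect_antitone s Hg ut.
have Ht := ler_wpM2l (w_ge0 a) (IH t); have Hu := ler_wpM2l (w_compl_ge0 a) (IH u).
apply: le_trans (lerD Ht Hu); rewrite -subr_ge0.
move: Ff Fg {Ht Hu}.
move: (expect s f t) (expect s f u) (expect s g t) (expect s g u).
move=> x y x' y' Ff Fg.
suff -> : w a * (x * x') + (1 - w a) * (y * y') -
   (w a * x + (1 - w a) * y) * (w a * x' + (1 - w a) * y')
   = w a * (1 - w a) * ((y - x) * (y' - x')) by rewrite !mulr_ge0 ?subr_ge0.
ring.
Qed.

Definition indep_of (a : K) f := forall o b, f (upd o a b) = f o.

Lemma expect_notin s a f o : a \notin s ->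
  expect s (fun o => (o a)%:R * f o) o = (o a)%:R * expect s f o.
Proof.
elim: s o => //= c s IH o; rewrite inE negb_or => /andP[ac /IH {}IH].
by rewrite !IH !upd_other //; ring.
Qed.

Lemma expect_indep s a f o b : indep_of a f ->
  expect s f (upd o a b) = expect s f o.
Proof.
move=> Hf; elim: s o => [|c s IH] o /=; first exact: Hf.
have [->|ac] := eqVneq a c; last by rewrite !(updC _ _ _ ac) !IH.
suff E e : upd (upd o c b) c e = upd o c e by rewrite !E.
by apply/funext => x; rewrite /upd; case: (x == c).
Qed.

Lemma expect_coin s a f o : uniq s -> a \in s -> indep_of a f ->
  expect s (fun o => (o a)%:R * f o) o = w a * expect s f o.
Proof.
elim: s o => //= c s IH o /andP[cs us]; rewrite inE.
have [-> _ Hf|ac /= as_ Hf] := eqVneq a c.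
  by rewrite !expect_notin // !upd_same !expect_indep //=; ring.
rewrite !IH //; ring.
Qed.

Lemma expect_coins s (t : seq K) o : uniq s -> uniq t -> {subset t <= s} ->
  expect s (fun o => (all o t)%:R) o = \prod_(a <- t) w a.
Proof.
move=> us; elim: t => [|a t IH] /=; first by rewrite big_nil expect_cst.
move=> /andP[at_ ut] sub; rewrite big_cons -IH //; last first.
  by move=> c ct; apply: sub; rewrite inE ct orbT.
rewrite -expect_coin //; last 2 first.
- by apply: sub; rewrite mem_head.
- move=> o' b; congr (_%:R); congr nat_of_bool; apply: eq_in_all => c ct.
  by rewrite upd_other //; apply: contraNneq at_ => <-.
by apply: eq_expect => o'; rewrite -natrM mulnb.
Qed.

End Coins.

(** * Addresses as integer points *)

Section Lattice.
Variable d : nat.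
Implicit Types (a b : address d) (u v w : 'rV[int]_d).

(** The binary digits of the [i]-th coordinate are read off the address, finest
    digit first; forgetting the [k] finest generations is then division by
    [2 ^ k] (see [coord_drop]). *)
Fixpoint coord a (i : 'I_d) : nat :=
  if a is e :: b then ((coord b i).*2 + e i)%N else 0%N.

Definition site a : 'rV[int]_d :=
  \row_i ((coord a i)%:Z - 2 ^+ (size a).-1).

Lemma coord_lt a i : (coord a i < 2 ^ size a)%N.
Proof. by elim: a => //= e b IH; rewrite expnS; case: (e i) => /=; lia. Qed.

Lemma coord_drop k a i : coord (drop k a) i = (coord a i %/ 2 ^ k)%N.
Proof.
elim: k a => [|k IH] [|e b] //=; rewrite ?divn1 ?div0n //.
rewrite IH expnS divnMA; congr (_ %/ _)%N.
by case: (e i) => /=; lia.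
Qed.

Lemma coord_inj a b : size a = size b -> coord a =1 coord b -> a = b.
Proof.
elim: a b => [|e a IH] [|e' b] //= [sab] eqc.
have h i : e i = e' i /\ coord a i = coord b i.
  by have := eqc i; case: (e i); case: (e' i) => /=; lia.
congr (_ :: _); first by apply/ffunP => i; case: (h i).
by apply: IH => // i; case: (h i).
Qed.

Lemma coord_surj k (c : 'I_d -> nat) : (forall i, c i < 2 ^ k)%N ->
  exists x : k.-tuple {ffun 'I_d -> bool}, coord x =1 c.
Proof.
elim: k c => [|k IH] c hc.
  by exists [tuple] => i /=; have := hc i; lia.
have [|x hx] := IH (fun i => (c i)./2).
  by move=> i; have := hc i; rewrite expnS; lia.
exists [tuple of [ffun i => odd (c i)] :: x] => i /=.
by rewrite hx ffunE addnC odd_double_half.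
Qed.

Lemma coord_rcons a e i : coord (rcons a e) i = (coord a i + e i * 2 ^ size a)%N.
Proof.
by elim: a => [|e' b IH] /=; rewrite ?muln1 ?IH ?expnS //; nia.
Qed.

Lemma site_inj k : injective (fun x : k.-tuple {ffun 'I_d -> bool} => site x).
Proof.
move=> x y /rowP eqs; apply: val_inj; apply: coord_inj => [|i].
  by rewrite !size_tuple.
by have := eqs i; rewrite !mxE !size_tuple => /addIr [].
Qed.

Lemma site_surj k v : (0 < k)%N -> box k v ->
  exists x : k.-tuple {ffun 'I_d -> bool}, site x = v.
Proof.
case: k => // k _ hv; have E : (2 ^+ k : int) = (2 ^ k)%N%:Z by rewrite -natz natrX.
have h i : exists c : nat, v 0 i = c%:Z - 2 ^+ k /\ (c < 2 ^ k.+1)%N.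
  have := hv i; rewrite /= E expnS => hi.
  by exists (absz (v 0 i + (2 ^ k)%N%:Z)%R); split; lia.
have [|x hx] := @coord_surj k.+1 (fun i => absz (v 0 i + 2 ^+ k)%R).
  by move=> i; have [c [-> hc]] := h i; rewrite subrK absz_nat.
exists x; apply/rowP => i; rewrite mxE size_tuple hx.
by have [c [-> hc]] := h i; rewrite subrK absz_nat.
Qed.

Lemma card_window (X : finType) (f : X -> 'rV[int]_d) (c : 'I_d -> int) N :
  injective f ->
  (#|[pred x | [forall i, c i <= f x 0 i <= c i + N%:Z]%R]|
    <= N.+1 ^ d)%N.
Proof.
move=> injf.
pose g x : {ffun 'I_d -> 'I_N.+1} := [ffun i => inord (absz (f x 0 i - c i)%R)].
set D := [pred x | _].
have injg : {in D &, injective g}.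
  move=> x y /forallP hx /forallP hy /ffunP eqg; apply/injf/rowP => i.
  have := eqg i; rewrite !ffunE => /(congr1 (@nat_of_ord _)).
  by rewrite !inordK; have := hx i; have := hy i; lia.
by rewrite -(card_in_imset injg) (leq_trans (max_card _)) // card_ffun !card_ord.
Qed.

(** The dyadic size of a displacement: the least [k] such that the sup norm is
    below [2 ^ k]. Two leaves whose difference has level [k] cannot share their
    ancestor at height smaller than [k] ([lev_site]), and up to constants
    [2 ^ lev z] is the Euclidean norm. *)
Definition lev w : nat := \max_i up_log 2 (absz (w 0%R i)).+1.

Lemma lev_le w k : (lev w <= k)%N = [forall i, (absz (w 0%R i) < 2 ^ k)%N].
Proof.
apply/bigmax_leqP/forallP => h i; have := h i.
  by move=> /(_ isT) hi; apply: leq_trans (up_logP _ (isT : (1 < 2)%N)) _; rewrite leq_exp2l.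
by move=> + _; apply: up_log_min.
Qed.

Lemma lev_bound w i : (absz (w 0%R i) < 2 ^ lev w)%N.
Proof. by move: i; apply/forallP; rewrite -lev_le. Qed.

Lemma levN w : lev (- w) = lev w.
Proof. by apply: eq_bigr => i _; rewrite mxE abszN. Qed.

Lemma levD_le u v k : (lev u <= k)%N -> (lev v <= k)%N -> (lev (u + v) <= k.+1)%N.
Proof.
rewrite !lev_le => /forallP hu /forallP hv; apply/forallP => i.
rewrite mxE expnS; have := hu i; have := hv i.
by move: (u 0%R i) (v 0%R i) => x y; lia.
Qed.

(** Leaves below a common node of height [k] lie in one cube of side [2 ^ k]. *)
Lemma lev_site k m (x y : m.-tuple {ffun 'I_d -> bool}) :
  drop k x = drop k y -> (lev (site x - site y) <= k)%N.
Proof.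
move=> xy; rewrite lev_le; apply/forallP => i; rewrite !mxE !size_tuple.
have: coord (drop k x) i = coord (drop k y) i by rewrite xy.
rewrite !coord_drop => h.
have := divn_eq (coord x i) (2 ^ k); have := divn_eq (coord y i) (2 ^ k).
have k0 : (0 < 2 ^ k)%N by rewrite expn_gt0.
have := ltn_pmod (coord x i) k0; have := ltn_pmod (coord y i) k0.
by rewrite h; lia.
Qed.

Lemma lev_siteB_le m (x y : m.-tuple {ffun 'I_d -> bool}) :
  (lev (site x - site y) <= m)%N.
Proof. by apply: lev_site; rewrite !drop_oversize ?size_tuple. Qed.

Lemma card_ball (X : finType) (f : X -> 'rV[int]_d) j : injective f ->
  (#|[pred x | lev (f x) <= j]| <= 2 ^ (d * j.+1))%N.
Proof.
move=> injf; have := card_window (fun=> - (2 ^ j)%N%:Z) (2 ^ j.+1).-1 injf.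
rewrite prednK ?expn_gt0 // mulnC expnM; apply: leq_trans.
apply: subset_leq_card; apply/fintype.subsetP => x; rewrite !inE lev_le => /forallP h.
by apply/forallP => i; have := h i; rewrite expnS; lia.
Qed.

End Lattice.

(** * Sums of powers over dyadic shells *)

Section PowerSums.
Variables (R : realFieldType) (d : nat).

(** There are at most [2 ^ (d * (j + 1))] points of level at most [j], so the sum
    over points is dominated by a geometric series over levels. *)
Lemma level_sum (X : finType) (f : X -> 'rV[int]_d) (Q : pred nat) (a : R) L :
  injective f -> 0 < a -> (forall x, Q (lev (f x)) -> lev (f x) < L)%N ->
  \sum_(x | Q (lev (f x))) a ^+ lev (f x)
    <= 2 ^+ d * \sum_(0 <= j < L | Q j) (2 ^+ d * a) ^+ j.
Proof.
move=> injf a0 hL.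
apply: (@le_trans _ _ (\sum_x \sum_(0 <= j < L | Q j) a ^+ j * (lev (f x) <= j)%N%:R)).
  rewrite big_mkcond; apply: ler_sum => x _; case: ifP => [Qx|_]; last first.
    by apply: sumr_ge0 => j _; rewrite mulr_ge0 ?exprn_ge0 ?(ltW a0) ?ler0n.
  rewrite big_mkcond (bigD1_seq (lev (f x))) ?mem_index_iota ?iota_uniq ?hL //=.
  rewrite Qx leqnn mulr1.
  rewrite lerDl; apply: sumr_ge0 => j _; case: ifP => // _.
  by rewrite mulr_ge0 ?exprn_ge0 ?(ltW a0) ?ler0n.
rewrite exchange_big mulr_sumr; apply: ler_sum => j _; rewrite -mulr_sumr.
have -> : \sum_x (lev (f x) <= j)%N%:R = #|[pred x | (lev (f x) <= j)%N]|%:R :> R.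
  rewrite -sum1_card natr_sum [RHS]big_mkcond; apply: eq_bigr => x _.
  by rewrite inE; case: (_ <= _)%N.
rewrite exprMn [leRHS]mulrA [leRHS]mulrC ler_wpM2l ?exprn_ge0 ?(ltW a0) //.
have := card_ball j injf; rewrite -(ler_nat R) natrX => /le_trans; apply.
by rewrite -exprM -exprD mulnS.
Qed.

Lemma geometric_le (b : R) k L : 0 <= b < 1 ->
  \sum_(k <= j < L) b ^+ j <= b ^+ k / (1 - b).
Proof.
case/andP=> b0 b1; have b1' : 0 < 1 - b by rewrite subr_gt0.
rewrite ler_pdivlMr //.
have [Lk|/ltnW kL] := leqP L k; first by rewrite big_geq // mul0r exprn_ge0.
rewrite mulr_suml.
under eq_bigr do rewrite mulrBr mulr1 -exprSr.
rewrite -[X in X <= _]opprK -sumrN.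
under eq_bigr do rewrite opprB.
by rewrite telescope_sumr // opprB lerBlDr lerDl exprn_ge0.
Qed.

Lemma geometric_ge (b : R) k : 1 < b ->
  \sum_(0 <= j < k.+1) b ^+ j <= b / (b - 1) * b ^+ k.
Proof.
move=> b1; have b1' : 0 < b - 1 by rewrite subr_gt0.
rewrite mulrAC ler_pdivlMr // -exprS mulr_suml.
under eq_bigr do rewrite mulrBr mulr1 -exprSr.
by rewrite telescope_sumr // expr0 lerBlDr lerDl.
Qed.

Lemma sum_small (X : finType) (f : X -> 'rV[int]_d) (a : R) k :
  injective f -> 0 < a -> 1 < 2 ^+ d * a ->
  \sum_(x | (lev (f x) <= k)%N) a ^+ lev (f x)
    <= 2 ^+ d * (2 ^+ d * a / (2 ^+ d * a - 1)) * (2 ^+ d * a) ^+ k.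
Proof.
move=> injf a0 a1.
apply: le_trans (level_sum (Q := fun j => (j <= k)%N) (L := k.+1) injf a0 _) _ => //.
rewrite -mulrA ler_wpM2l ?exprn_ge0 //; apply: le_trans (geometric_ge _ a1).
rewrite big_mkcond; apply: ler_sum_nat => j /andP[_ jk].
by rewrite -ltnS jk.
Qed.

Lemma sum_large (X : finType) (f : X -> 'rV[int]_d) (a : R) k :
  injective f -> 0 < a -> 2 ^+ d * a < 1 ->
  \sum_(x | (k <= lev (f x))%N) a ^+ lev (f x)
    <= 2 ^+ d / (1 - 2 ^+ d * a) * (2 ^+ d * a) ^+ k.
Proof.
move=> injf a0 a1.
have b0 : 0 < 2 ^+ d * a by rewrite mulr_gt0 ?exprn_gt0.
pose L := (\max_x lev (f x)).+1.
have hL x : (lev (f x) < L)%N by rewrite ltnS (leq_bigmax x).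
apply: le_trans (level_sum (Q := fun j => (k <= j)%N) (L := L) injf a0 _) _ => //.
rewrite -mulrA ler_wpM2l ?exprn_ge0 //.
rewrite [leRHS]mulrC; apply: le_trans (geometric_le k L _); last first.
  by rewrite (ltW b0).
by rewrite (big_nat_widenl k 0) // big_mkcond [leRHS]big_mkcond /=.
Qed.

Definition convolution_cst (p q : R) : R :=
  let A a := 2 ^+ d * (2 ^+ d * a / (2 ^+ d * a - 1)) * (2 ^+ d * a) in
  A p / q + A q / p + 2 ^+ d / (1 - 2 ^+ d * (p * q)) / q.

(** The discrete form of the convolution of [|x|^-s] with [|x|^-t] being
    [|x|^(d - s - t)] when [s, t < d < s + t]. With [k] the level of [v], either
    one of the two summands has level at least [k - 1] and the other one level at
    most [k + 1], which gives a sum dominated by its largest shell, or the first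
    is far from the origin and then both levels are comparable, which gives a
    convergent tail. *)
Lemma convolution_le (X : finType) (f g : X -> 'rV[int]_d) v (p q : R) :
  injective f -> injective g -> (forall x, v = f x + g x) ->
  0 < p < 1 -> 0 < q < 1 ->
  1 < 2 ^+ d * p -> 1 < 2 ^+ d * q -> 2 ^+ d * (p * q) < 1 ->
  \sum_x p ^+ lev (f x) * q ^+ lev (g x)
    <= convolution_cst p q * (2 ^+ d * (p * q)) ^+ lev v.
Proof.
move=> injf injg fg /andP[p0 p1] /andP[q0 q1] P1 Q1 r1.
set k := lev v.
have pq0 : 0 < p * q by rewrite mulr_gt0.
have r0 : 0 < 2 ^+ d * (p * q) by rewrite mulr_gt0 ?exprn_gt0.
have expw (a : R) i j : 0 < a -> a < 1 -> (i <= j.+1)%N -> a ^+ j <= a ^+ i / a.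
  move=> a0 a1 ij; rewrite ler_pdivlMr // -exprSr.
  by apply: ler_wiXn2l => //; apply/ltW.
pose T1 x := if (lev (f x) <= k.+1)%N then p ^+ lev (f x) * (q ^+ k / q) else 0.
pose T2 x := if (lev (g x) <= k.+1)%N
             then q ^+ lev (g x) * (p ^+ k / p) else 0.
pose T3 x := if (k.+2 <= lev (f x))%N then (p * q) ^+ lev (f x) / q else 0.
have T10 x : 0 <= T1 x.
  by rewrite /T1; case: ifP => // _; rewrite !mulr_ge0 ?invr_ge0 ?exprn_ge0 ?ltW.
have T20 x : 0 <= T2 x.
  by rewrite /T2; case: ifP => // _; rewrite !mulr_ge0 ?invr_ge0 ?exprn_ge0 ?ltW.
have T30 x : 0 <= T3 x.
  by rewrite /T3; case: ifP => // _; rewrite !mulr_ge0 ?invr_ge0 ?exprn_ge0 ?ltW.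
apply: (@le_trans _ _ (\sum_x (T1 x + T2 x + T3 x))).
  apply: ler_sum => x _.
  have [jk|kj] := ltnP (lev (f x)) k.+2; last first.
    rewrite -[leLHS]add0r lerD ?addr_ge0 // /T3 kj exprMn -mulrA ler_wpM2l ?exprn_ge0
      ?(ltW p0) //.
    apply: expw => //; rewrite leqNgt; apply/negP => h.
    have h1 : (lev v <= (lev (f x)).-2)%N by rewrite -/k; lia.
    have h2 : (lev (- g x) <= (lev (f x)).-2)%N by rewrite levN; lia.
    by have := levD_le h1 h2; rewrite (fg x) addrK; lia.
  have [kl|lk] := leqP k (lev (g x)).+1.
    rewrite -addrA -[leLHS]addr0 lerD ?addr_ge0 // /T1 -ltnS jk.
    by rewrite ler_wpM2l ?exprn_ge0 ?(ltW p0) ?expw.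
  rewrite addrAC -[leLHS]add0r lerD ?addr_ge0 // /T2.
  have -> : (lev (g x) <= k.+1)%N by lia.
  rewrite mulrC ler_wpM2l ?exprn_ge0 ?(ltW q0) ?expw // leqNgt; apply/negP => h.
  have h1 : (lev (g x) <= k.-2)%N by lia.
  have h2 : (lev (f x) <= k.-2)%N by lia.
  by have := levD_le h2 h1; rewrite -fg -/k; lia.
rewrite !big_split /= /convolution_cst 2!mulrDl.
have rk : (2 ^+ d * (p * q)) ^+ k = (2 ^+ d * p) ^+ k * q ^+ k.
  by rewrite !exprMn mulrA.
have rk' : (2 ^+ d * (p * q)) ^+ k = (2 ^+ d * q) ^+ k * p ^+ k.
  by rewrite !exprMn -mulrA (mulrC (q ^+ k)).
have alg (A B x y z : R) : A * (B * x) * (y / z) = A * B / z * (x * y) by ring.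
apply: lerD; first apply: lerD.
- have -> : \sum_x T1 x = (\sum_(x | (lev (f x) <= k.+1)%N) p ^+ lev (f x)) * (q ^+ k / q).
    by rewrite mulr_suml [RHS]big_mkcond.
  apply: le_trans (ler_wpM2r _ (sum_small k.+1 injf p0 P1)) _.
    by rewrite mulr_ge0 ?exprn_ge0 ?invr_ge0 ?ltW.
  by rewrite rk exprS alg.
- have -> : \sum_x T2 x = (\sum_(x | (lev (g x) <= k.+1)%N) q ^+ lev (g x)) * (p ^+ k / p).
    by rewrite mulr_suml [RHS]big_mkcond.
  apply: le_trans (ler_wpM2r _ (sum_small k.+1 injg q0 Q1)) _.
    by rewrite mulr_ge0 ?exprn_ge0 ?invr_ge0 ?ltW.
  by rewrite rk' exprS alg.
- have -> : \sum_x T3 x = (\sum_(x | (k.+2 <= lev (f x))%N) (p * q) ^+ lev (f x)) / q.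
    by rewrite mulr_suml [RHS]big_mkcond.
  apply: le_trans (ler_wpM2r _ (sum_large k.+2 injf pq0 r1)) _.
    by rewrite invr_ge0 ltW.
  rewrite mulrAC ler_wpM2l //.
    by rewrite !mulr_ge0 ?invr_ge0 ?subr_ge0 ?exprn_ge0 ?(ltW r1) ?(ltW q0).
  by apply: ler_wiXn2l; rewrite ?(ltW r0) ?(ltW r1) //; lia.
Qed.

Lemma convolution_cst_gt0 (p q : R) : 0 < p -> 0 < q ->
  1 < 2 ^+ d * p -> 1 < 2 ^+ d * q -> 2 ^+ d * (p * q) < 1 -> 0 < convolution_cst p q.
Proof.
move=> p0 q0 P1 Q1 r1; have t0 : 0 < 2 ^+ d :> R by rewrite exprn_gt0.
by rewrite /convolution_cst !addr_gt0 ?divr_gt0 ?mulr_gt0 ?invr_gt0 ?subr_gt0.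
Qed.

End PowerSums.

(** * From the probability space to finitely many coins *)

Section Transfer.
Variables (R : realType) (d : nat).
Local Notation vertex := {ffun 'I_d -> bool}.

Fixpoint alive (o : address d -> bool) (a : address d) : bool :=
  if a is e :: b then o a && alive o b else true.

Definition nodes N : seq (address d) :=
  undup (flatten [seq [seq tval x | x <- enum {: k.+1.-tuple vertex}] | k <- iota 0 N]).

Lemma mem_nodes N a : (a \in nodes N) = (0 < size a <= N)%N.
Proof.
rewrite mem_undup; apply/flatten_mapP/idP => [[k]|].
  rewrite mem_iota => kN /mapP[x _ ->]; rewrite size_tuple; lia.
case: a => [|e a] //= aN; exists (size a); first by rewrite mem_iota.
by apply/mapP; exists (in_tuple (e :: a)); rewrite ?mem_enum.
Qed.

Lemma alive_drop o a :
  alive o a = all o [seq drop k a | k <- iota 0 (size a)].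
Proof.
elim: a => //= e b IH; rewrite IH; congr (_ && _).
by rewrite (iotaDl 1 0) -map_comp.
Qed.

Lemma eq_alive o o' a N : (size a <= N)%N ->
  {in nodes N, o =1 o'} -> alive o a = alive o' a.
Proof.
move=> aN oo'; rewrite !alive_drop; apply: eq_in_all => b /mapP[k].
rewrite mem_iota => kN ->; apply: oo'; rewrite mem_nodes size_drop.
by move: kN aN; move: (size a) => l; lia.
Qed.

Definition coins_of (dT : measure_display) (T : measurableType dT)
  (keep : address d -> set T) (t : T) (a : address d) : bool := `[< keep a t >].

Section OneTree.
Variables (dT : measure_display) (T : measurableType dT) (P : probability T R).
Variables (p : R) (keep : address d -> set T).
Hypothesis hkeep : percolation_coins P p keep.

Definition reveal (s : seq (address d)) (o : address d -> bool) (t : T) a :=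
  if a \in s then coins_of keep t a else o a.

(** The sets [keep a] behave as independent coins. Only intersections of kept
    events have a prescribed probability, so the induction carries such an
    intersection over [u] along and obtains the event that the next coin is off
    as a set difference. *)
Lemma expect_law (s u : seq (address d)) (o : address d -> bool)
    (phi : (address d -> bool) -> bool) :
  uniq (u ++ s) -> [::] \notin u ++ s ->
  let B := \bigcap_(a in [set` u]) keep a `&` [set t | phi (reveal s o t)] in
  measurable B /\
  P B = (p ^+ size u * expect (fun=> p) s (fun o => (phi o)%:R) o)%:E.
Proof.
case: hkeep => mk Pk ik.
have mu (v : seq (address d)) : [::] \notin v ->
    measurable (\bigcap_(a in [set` v]) keep a).
  move=> nv; apply: fin_bigcap_measurable => [|a /= av].
    exact: finite_seq.
  by apply: mk; apply: contraNneq nv => <-.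
elim: s u o => [|a s IH] u o us ns B.
  rewrite cats0 in us ns; have Pu : P (\bigcap_(a in [set` u]) keep a) = (p ^+ size u)%:E.
    rewrite ik //; rewrite big_seq (eq_bigr (fun=> p%:E)); last first.
      by move=> a au; rewrite Pk //; apply: contraNneq ns => <-.
    rewrite -big_seq; elim: (u) => [|b v IHv]; first by rewrite big_nil.
    by rewrite big_cons IHv exprS EFinM.
  have [ph|ph] := boolP (phi o).
    have -> : B = \bigcap_(a in [set` u]) keep a.
      by rewrite /B; apply/seteqP; split => t //= [].
    by split; [exact: mu|rewrite /= ph mulr1].
  have -> : B = set0.
    apply/seteqP; split => t //= -[_ /=].
    by have -> : reveal [::] o t = o by []; rewrite (negbTE ph).
  by split; [exact: measurable0|rewrite measure0 /= (negbTE ph) mulr0].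
move: (us) (ns); rewrite cat_uniq /= !mem_cat !inE => /and3P[uu hus /andP[as_ us']].
move=> /norP[nu /norP[na ns']].
have au : a \notin u by apply: contra hus => h; rewrite h.
have hus' : ~~ has (in_mem^~ (mem u)) s by apply: contra hus => h; rewrite h orbT.
have na' : a != [::] by rewrite eq_sym.
set o1 := upd o a true; set o0 := upd o a false.
have us1 : uniq (u ++ s) by rewrite cat_uniq uu hus' us'.
have ns1 : [::] \notin u ++ s by rewrite mem_cat negb_or nu ns'.
have us2 : uniq ((a :: u) ++ s) by rewrite /= us1 andbT mem_cat negb_or au.
have ns2 : [::] \notin (a :: u) ++ s by rewrite inE negb_or na.
have [mA PA] := IH (a :: u) o1 us2 ns2.
have [mB PB] := IH u o0 us1 ns1.
have [mC PC] := IH (a :: u) o0 us2 ns2.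
set A1 := (X in P X = _) in PA; set B1 := (X in P X = _) in PB.
set C1 := (X in P X = _) in PC.
have revE t b : `[< keep a t >] = b -> reveal (a :: s) o t = reveal s (upd o a b) t.
  move=> kb; apply/funext => c; rewrite /reveal inE /upd.
  have [->|ca] := eqVneq c a; last by [].
  by rewrite (negbTE as_) -kb.
(* Split according to the coin [a]: on it, or off but not on. *)
have BE : B = A1 `|` (B1 `\` C1).
  apply/seteqP; split => t.
    move=> [/= tu th]; have [ka|ka] := pselect (keep a t).
      left; split => [b /=|/=]; last by rewrite -(revE _ true) //; apply/asboolP.
      by rewrite inE => /orP[/eqP ->|/tu].
    right; split; first by split => //=; rewrite -(revE _ false) //; apply/asboolPn.
    by move=> [/(_ a)]; rewrite /= mem_head => /(_ isT).
  case=> [[tu /= th]|[[tu /= th] nC]].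
    split => [b /= bu|/=]; first by apply: tu; rewrite /= inE bu orbT.
    by rewrite (revE _ true) //; apply/asboolP; apply: tu; rewrite /= mem_head.
  split => //=; rewrite (revE _ false) //; apply/asboolPn => ka; apply: nC.
  by split => [b /=|//]; rewrite inE => /orP[/eqP ->|/tu].
have CB : B1 `&` C1 = C1.
  apply/seteqP; split => t [] // h1 h2; split; split => //.
  by move=> b /= bu; apply: h1; rewrite /= inE bu orbT.
have dis : A1 `&` (B1 `\` C1) = set0.
  apply/seteqP; split => t // [[h1 _] [h2 h3]]; apply: h3; split => //.
  by case: h2.
split; first by rewrite BE; apply: measurableU => //; apply: measurableD.
have PU : P (A1 `|` (B1 `\` C1)) = (P A1 + P (B1 `\` C1))%E.
  by apply: measureU => //; apply: measurableD.
have PD : P (B1 `\` C1) = (P B1 - P (B1 `&` C1))%E.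
  by apply: measureD => //; apply: le_lt_trans (probability_le1 P mB) (ltry 1).
rewrite BE PU PD CB PA PB PC -EFinB -EFinD /=; congr EFin; rewrite exprS; ring.
Qed.

Definition alive_leaves k (o : address d -> bool) : {ffun k.-tuple vertex -> bool} :=
  [ffun x => alive o (tval x)].

Lemma alive_law k N (s : {ffun k.-tuple vertex -> bool}) : (k <= N)%N ->
  measurable [set t | alive_leaves k (coins_of keep t) = s] /\
  P [set t | alive_leaves k (coins_of keep t) = s] =
  (expect (fun=> p) (nodes N) (fun o => (alive_leaves k o == s)%:R) (fun=> false))%:E.
Proof.
move=> kN.
have := @expect_law (nodes N) [::] (fun=> false) (fun o => alive_leaves k o == s).
rewrite cat0s mem_nodes => /(_ (undup_uniq _) isT) /=.
rewrite set_nil bigcap_set0 setTI expr0 mul1r.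
set S := (X in measurable X); set S' := (X in _ -> measurable X /\ _).
suff SE : S = S' by case=> mS PS; rewrite -/S' -SE; split.
have E t : alive_leaves k (reveal (nodes N) (fun=> false) t) =
    alive_leaves k (coins_of keep t).
  apply/ffunP => x; rewrite !ffunE; apply: (@eq_alive _ _ _ N).
    by rewrite size_tuple.
  by move=> a aN; rewrite /reveal aN.
by apply/seteqP; split => t; rewrite /S /S' /= E => /eqP.
Qed.

Lemma Z_alive k t (a : address d) :
  Z keep k t a <-> size a = k /\ alive (coins_of keep t) a.
Proof.
elim: k a => [|k IH] a /=.
  by split => [->//|[/size0nil]].
split.
  by move=> [e [b [-> /IH[<- hb] ka]]]; split => //=; rewrite hb andbT; apply/asboolP.
case: a => [[]|e b] //= [[sb]] /andP[/asboolP ka hb].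
by exists e, b; split => //; apply/IH.
Qed.

Lemma corner_coord (a : address d) i :
  corner R a 0 i = (coord a i)%:R * 2 ^- size a - 2^-1.
Proof.
elim: a => [|e b IH] /=; first by rewrite mxE mul0r sub0r.
rewrite !mxE IH natrD -addnn natrD exprS invfM.
have : (2 : R) != 0 by rewrite pnatr_eq0.
by move: (2 ^- size b : R) => y n2; field.
Qed.

(** The points of the percolation set are the sites of the leaves that are
    connected to the root: a half-open cube of side [2 ^- k] scaled by [2 ^ k]
    contains exactly one integer point. *)
Lemma Q_alive k t (z : 'rV[int]_d) : (0 < k)%N ->
  Q R keep k t z <->
  exists2 x : k.-tuple vertex, alive (coins_of keep t) x & z = site x.
Proof.
case: k => // k _.
have t0 : 0 < 2 ^+ k.+1 :> R by rewrite exprn_gt0.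
have half : 2 ^+ k.+1 * 2^-1 = 2 ^+ k :> R by rewrite exprSr mulfK // pnatr_eq0.
have siteE (a : address d) i : size a = k.+1 ->
    2 ^+ k.+1 * corner R a 0 i = (site a 0 i)%:~R.
  move=> sa; rewrite corner_coord mxE sa /= mulrBr half mulrCA divff ?gt_eqF //.
  by rewrite mulr1 rmorphB /= rmorphXn.
split.
  move=> [a /Z_alive[sa ha] [x xa /rowP zx]].
  have sa' : size a == k.+1 by rewrite sa.
  exists (Tuple sa') => //=; apply/rowP => i; apply/eqP.
  have zi : (z 0 i)%:~R = 2 ^+ k.+1 * x 0 i by have := zx i; rewrite !mxE.
  have /andP[h1 h2] := xa i.
  rewrite eq_le -ltzD1 -(ltr_int R) -(ler_int R) rmorphD /= zi -(siteE _ _ sa).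
  rewrite ler_pM2l // h1 andbT.
  have -> : 2 ^+ k.+1 * corner R a 0 i + 1 = 2 ^+ k.+1 * (corner R a 0 i + 2 ^- size a).
    by rewrite mulrDr sa divff ?gt_eqF.
  by rewrite ltr_pM2l.
move=> [x hx ->]; exists (tval x); first by apply/Z_alive; rewrite size_tuple.
exists (corner R x).
  by move=> i; rewrite lexx ltrDl invr_gt0 size_tuple.
by apply/rowP => i; rewrite mxE [RHS]mxE siteE ?size_tuple.
Qed.

(** The independence hypothesis speaks of the sigma-algebras of the two
    percolation sets, not of the coins, so the events to which it is applied have
    to be expressed through the sets themselves. *)
Lemma alive_process k (s : {ffun k.-tuple vertex -> bool}) : (0 < k)%N ->
  <<s process_events (Q R keep) >> [set t | alive_leaves k (coins_of keep t) = s].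
Proof.
move=> k0.
pose E (x : k.-tuple vertex) := [set t | Q R keep k t (site x)].
have mE x : <<s process_events (Q R keep) >> (E x).
  by apply: sub_sigma_algebra; exists k, (site x).
have -> : [set t | alive_leaves k (coins_of keep t) = s] =
    \bigcap_(x in [set: k.-tuple vertex]) (if s x then E x else ~` E x).
  have EE x t : E x t <-> alive (coins_of keep t) x.
    rewrite /E /= Q_alive //; split => [[y ya /site_inj ->]//|h]; by exists x.
  apply/seteqP; split => t /=.
    move=> st x _; move/ffunP: st => /(_ x); rewrite ffunE.
    by case: (s x) => h; [apply/EE|move=> /EE; rewrite h].
  move=> h; apply/ffunP => x; rewrite ffunE; have := h x I.
  by case: (s x); [move/EE|move=> nE; apply/negbTE/negP => /EE].
apply: (@fin_bigcap_measurable _ (g_sigma_algebraType (process_events (Q R keep)))).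
  exact: finite_finset.
by move=> x _; case: (s x); [exact: mE|apply: sigma_algebraC; exact: mE].
Qed.

End OneTree.

Definition coin_wt (p q : R) (c : address d + address d) : R :=
  if c is inl _ then p else q.

Definition coins N : seq (address d + address d) :=
  map inl (nodes N) ++ map inr (nodes N).

Definition hits m n (A : {fset 'rV[int]_d}) (o : address d + address d -> bool) : bool :=
  [exists x : m.-tuple vertex, exists y : n.-tuple vertex,
    [&& alive (fun a => o (inl a)) x, alive (fun b => o (inr b)) y
      & site x + site y \in A]].

Lemma expect_inl p q s f g o :
  expect (coin_wt p q) (map inl s)
    (fun o => f (fun a => o (inl a)) * g (fun b => o (inr b))) o
  = expect (fun=> p) s f (fun a => o (inl a)) * g (fun b => o (inr b)).
Proof.
elim: s o => //= a s IH o; rewrite !IH /=.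
have E b : (fun c => upd o (inl a) b (inl c)) = upd (fun c => o (inl c)) a b.
  by apply/funext => c; rewrite /upd.
by rewrite !E; ring.
Qed.

Lemma expect_inr p q s f g o :
  expect (coin_wt p q) (map inr s)
    (fun o => f (fun a => o (inl a)) * g (fun b => o (inr b))) o
  = f (fun a => o (inl a)) * expect (fun=> q) s g (fun b => o (inr b)).
Proof.
elim: s o => //= a s IH o; rewrite !IH /=.
have E b : (fun c => upd o (inr a) b (inr c)) = upd (fun c => o (inr c)) a b.
  by apply/funext => c; rewrite /upd.
by rewrite !E; ring.
Qed.

Lemma expect_product p q N f g :
  expect (coin_wt p q) (coins N)
    (fun o => f (fun a => o (inl a)) * g (fun b => o (inr b))) (fun=> false)
  = expect (fun=> p) (nodes N) f (fun=> false)
    * expect (fun=> q) (nodes N) g (fun=> false).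
Proof.
rewrite expect_cat (eq_expect _ _ _ (expect_inr p q _ f g)).
exact: (expect_inl p q _ f (fun o' => expect (fun=> q) (nodes N) g o') _).
Qed.

(** The hitting event depends on finitely many leaves of each tree. It is split
    according to the two sets of surviving leaves; independence factorizes each
    piece and [expect_law] evaluates both factors. *)
Lemma hit_law (dT : measure_display) (T : measurableType dT) (P : probability T R)
    (p q : R) (keep keep' : address d -> set T) m n (A : {fset 'rV[int]_d}) :
  percolation_coins P p keep -> percolation_coins P q keep' ->
  independent_processes P (Q R keep) (Q R keep') -> (0 < m <= n)%N ->
  P [set t | sumset (Q R keep m t) (Q R keep' n t) `&` [set` A] !=set0]
  = (expect (coin_wt p q) (coins n) (fun o => (hits m n A o)%:R) (fun=> false))%:E.
Proof.
move=> hk hk' ind /andP[m0 mn]; have n0 := leq_trans m0 mn.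
pose S1 := {ffun m.-tuple vertex -> bool}; pose S2 := {ffun n.-tuple vertex -> bool}.
pose good (ss : S1 * S2) := [exists x, exists y,
  [&& ss.1 x, ss.2 y & site x + site y \in A]].
pose E (s : S1) := [set t | alive_leaves m (coins_of keep t) = s].
pose E' (s : S2) := [set t | alive_leaves n (coins_of keep' t) = s].
pose L := [seq ss <- enum {: S1 * S2} | good ss].
have uL : uniq L by rewrite filter_uniq ?enum_uniq.
have -> : [set t | sumset (Q R keep m t) (Q R keep' n t) `&` [set` A] !=set0] =
    \bigcup_(ss in [set` L]) (E ss.1 `&` E' ss.2).
  apply/seteqP; split => t /=.
    move=> [z [[x /(Q_alive _ _ _ m0)[a ha ->] [y /(Q_alive _ _ _ n0)[b hb ->] <-]] /= zA]].
    exists (alive_leaves m (coins_of keep t), alive_leaves n (coins_of keep' t)) => //=.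
    rewrite mem_filter mem_enum andbT; apply/existsP; exists a; apply/existsP; exists b.
    by rewrite /= !ffunE ha hb.
  move=> [[s s'] /=]; rewrite mem_filter => /andP[].
  move=> /existsP[x /existsP[y /and3P[/= sx sy xyA]]] _.
  move=> [Es Es']; exists (site x + site y); split => //=.
  exists (site x).
    by apply/Q_alive => //; exists x => //; move: sx; rewrite -Es ffunE.
  exists (site y) => //.
  by apply/Q_alive => //; exists y => //; move: sy; rewrite -Es' ffunE.
have mE s : measurable (E s) by case: (alive_law hk s mn).
have mE' s : measurable (E' s) by case: (alive_law hk' s (leqnn n)).
rewrite measure_fin_bigcup; last 3 first.
- exact: finite_seq.
- by move=> [s s'] [r r'] _ _ [t [[/= <- <-] [/= <- <-]]].
- by move=> ss _; apply: measurableI.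
rewrite -fsbig_seq // big_filter big_enum_cond /=.
pose F1 s o : R := (alive_leaves m o == s)%:R.
pose F2 s o : R := (alive_leaves n o == s)%:R.
rewrite (eq_bigr (fun ss => (expect (fun=> p) (nodes n) (F1 ss.1) (fun=> false) *
    expect (fun=> q) (nodes n) (F2 ss.2) (fun=> false))%:E)); last first.
  move=> ss _; rewrite ind; try exact: alive_process.
  have [_ ->] := alive_law hk ss.1 mn.
  by have [_ ->] := alive_law hk' ss.2 (leqnn n).
rewrite sumEFin; congr EFin.
under eq_bigr do rewrite -expect_product.
rewrite -expect_sum; apply: eq_expect => o.
pose ss0 := (alive_leaves m (fun a => o (inl a)), alive_leaves n (fun b => o (inr b))).
have -> : hits m n A o = good ss0.
  by rewrite /hits /good; apply: eq_existsb => x; apply: eq_existsb => y; rewrite !ffunE.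
rewrite big_mkcond (bigD1 ss0) //= /F1 /F2 !eqxx mulr1 big1 => [|[s s'] ne].
  by rewrite addr0; case: ifP.
case: ifP => // _; rewrite -natrM mulnb -xpair_eqE.
by rewrite eq_sym (negbTE ne).
Qed.

End Transfer.

(** * Pairs of leaves and the lower bound *)

Section LeafPairs.
Variables (R : realType) (d : nat) (p q : R) (m n : nat).
Hypotheses (p01 : 0 < p < 1) (q01 : 0 < q < 1) (m_gt0 : (0 < m)%N) (mn : (m <= n)%N).
Local Notation vertex := {ffun 'I_d -> bool}.
Local Notation pair := (m.-tuple vertex * n.-tuple vertex)%type.
Local Notation config := (address d + address d -> bool).
Local Notation w := (coin_wt (d := d) p q).
Implicit Types (u v : pair) (o : config).

Definition sigma u : 'rV[int]_d := site u.1 + site u.2.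

Definition live u o : bool :=
  alive (fun a => o (inl a)) u.1 && alive (fun b => o (inr b)) u.2.

Lemma coin_wt01 c : 0 <= w c <= 1.
Proof. by case: c => a /=; case/andP: p01; case/andP: q01 => *; rewrite !ltW. Qed.

Lemma hitsE (A : {fset 'rV[int]_d}) o :
  hits m n A o = [exists u, (sigma u \in A) && live u o].
Proof.
apply/existsP/existsP.
  by move=> [x /existsP[y /and3P[hx hy h]]]; exists (x, y); rewrite /live /= h hx.
move=> [[x y] /and3P[/= h hx hy]]; exists x; apply/existsP; exists y.
by rewrite /= hx hy.
Qed.

Definition lineage k (a : address d) := [seq drop i a | i <- iota 0 k].

Lemma lineage_nodes k l N (x : k.-tuple vertex) : (l <= k <= N)%N ->
  {subset lineage l x <= nodes d N}.
Proof.
move=> lk a /mapP[i]; rewrite mem_iota => il ->.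
by rewrite mem_nodes size_drop size_tuple; lia.
Qed.

Lemma uniq_lineage k l (x : k.-tuple vertex) : (l <= k)%N -> uniq (lineage l x).
Proof.
move=> lk; rewrite map_inj_in_uniq ?iota_uniq // => i j; rewrite !mem_iota => hi hj.
by move/(congr1 size); rewrite !size_drop size_tuple; lia.
Qed.

(** The coins on which the survival of two leaves depends are distinct as long
    as only the ancestors of the second leaf below the branching point are
    listed, and the branching point lies at height at least [lev]. *)
Lemma uniq_lineages k l (x y : k.-tuple vertex) : (l <= lev (site x - site y))%N ->
  uniq (lineage k x ++ lineage l y).
Proof.
move=> lk; have lk' := leq_trans lk (lev_siteB_le x y).
rewrite cat_uniq !uniq_lineage //= andbT; apply/hasPn => a /mapP[i].
rewrite mem_iota => il ->; apply/negP => /mapP[j]; rewrite mem_iota => jk yx.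
have ij : i = j.
  by move: (congr1 size yx); rewrite !size_drop !size_tuple; lia.
by move: yx; rewrite ij => /esym /lev_site; lia.
Qed.

Lemma lineages_law (s t : seq (address d)) : uniq s -> uniq t ->
  {subset s <= nodes d n} -> {subset t <= nodes d n} ->
  expect w (coins d n) (fun o => (all o (map inl s ++ map inr t))%:R) (fun=> false)
  = p ^+ size s * q ^+ size t.
Proof.
move=> us ut sn tn; rewrite expect_coins.
- rewrite big_cat !big_map /= !big_const_seq !count_predT /=.
  by rewrite -!Monoid.iteropE.
- rewrite cat_uniq !map_inj_uniq ?undup_uniq //=; try by move=> ? ? [].
  by rewrite andbT; apply/hasPn => c /mapP[b _ ->]; apply/negP => /mapP[].
- rewrite cat_uniq !map_inj_uniq //=; try by move=> ? ? [].
  by rewrite us ut andbT; apply/hasPn => c /mapP[b _ ->]; apply/negP => /mapP[].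
- move=> c; rewrite !mem_cat => /orP[] /mapP[a ha ->].
    by rewrite map_f ?sn.
  by rewrite orbC map_f ?tn.
Qed.

Lemma liveE u o : live u o = all o (map inl (lineage m u.1) ++ map inr (lineage n u.2)).
Proof. by rewrite /live !alive_drop !size_tuple all_cat !all_map. Qed.

Lemma live_law u :
  expect w (coins d n) (fun o => (live u o)%:R) (fun=> false) = p ^+ m * q ^+ n.
Proof.
under eq_expect do rewrite liveE.
rewrite lineages_law ?uniq_lineage ?size_map ?size_iota //.
  by apply: lineage_nodes; rewrite leqnn.
by apply: lineage_nodes; rewrite !leqnn.
Qed.

(** Since the two leaves of each tree branch at height at least [lev], at least
    that many coins are used by the second leaf only. *)
Lemma live2_le u v :
  expect w (coins d n) (fun o => (live u o)%:R * (live v o)%:R) (fun=> false) <=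
  p ^+ m * q ^+ n * (p ^+ lev (site u.1 - site v.1) * q ^+ lev (site u.2 - site v.2)).
Proof.
set j := lev _; set l := lev _.
have jm : (j <= m)%N := lev_siteB_le _ _.
have ln : (l <= n)%N := lev_siteB_le _ _.
pose s := lineage m u.1 ++ lineage j v.1; pose t := lineage n u.2 ++ lineage l v.2.
have -> : p ^+ m * q ^+ n * (p ^+ j * q ^+ l) = p ^+ size s * q ^+ size t.
  by rewrite !size_cat !size_map !size_iota !exprD mulrACA.
rewrite -lineages_law ?uniq_lineages //; last 2 first.
- move=> a; rewrite mem_cat => /orP[]; apply: lineage_nodes; first by rewrite leqnn.
  by rewrite jm.
- by move=> a; rewrite mem_cat => /orP[]; apply: lineage_nodes; rewrite ?leqnn ?ln.
apply: le_expect => [|o]; first exact: coin_wt01.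
rewrite -natrM mulnb ler_nat; case: (boolP (_ && _)) => //.
have sub (f : address d -> address d + address d) k i a : (i <= k)%N ->
    all o (map f (lineage k a)) -> all o (map f (lineage i a)).
  move=> ik /allP h; apply/allP => b /mapP[c] /mapP[e]; rewrite mem_iota => ei -> ->.
  by apply: h; do 2 apply: map_f; rewrite mem_iota; lia.
rewrite !liveE /s /t !map_cat !all_cat => /andP[/andP[-> ->] /andP[h1 h2]] /=.
by rewrite (sub _ _ _ _ jm h1) (sub _ _ _ _ ln h2).
Qed.

Lemma sum_fiber (A : {fset 'rV[int]_d}) (H : 'rV[int]_d -> pair -> R) :
  \sum_(u | sigma u \in A) H (sigma u) u
  = \sum_(z <- A) \sum_(u | sigma u == z) H z u.
Proof.
under [RHS]eq_bigr do rewrite big_mkcond.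
rewrite exchange_big big_mkcond; apply: eq_bigr => u _; case: ifP => uA.
  rewrite (bigD1_seq (sigma u)) ?fset_uniq //= eqxx big1 ?addr0 // => z /negbTE.
  by rewrite eq_sym => ->.
rewrite big_seq big1 // => z zA; case: eqP => // uz.
by move: uA; rewrite uz zA.
Qed.

(** A point [z] of the box is reached from every leaf [x] of the first tree whose
    coordinates have the same signs as those of [z], because subtracting such an
    [x] cannot push [z] out of the box. The sign is the coarsest digit of the
    address. *)
Lemma fiber_ge z : box n z ->
  ((2 ^ d) ^ m.-1 <= #|[pred u | sigma u == z]|)%N.
Proof.
move=> zb; (* The coarsest digit of every first leaf is the sign of [z]. *)
pose e : vertex := [ffun i => 0 <= z 0 i].
pose lift (x : m.-1.-tuple vertex) : seq vertex := rcons x e.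
have lift_size x : size (lift x) == m by rewrite size_rcons size_tuple prednK.
pose X x : m.-tuple vertex := Tuple (lift_size x).
have Xz x : box n (z - site (X x)).
  move=> i; have := zb i; have := coord_lt x i; rewrite !mxE size_tuple.
  rewrite coord_rcons (eqP (lift_size x)) size_tuple ffunE.
  have E k : (2 ^+ k : int) = (2 ^ k)%N%:Z by rewrite -natz natrX.
  have : (2 ^ m.-1 <= 2 ^ n.-1)%N by rewrite leq_exp2l //; lia.
  by rewrite !E; case: (lerP 0 (z 0 i)); move: (z 0 i) => zi; lia.
have n0 : (0 < n)%N := leq_trans m_gt0 mn.
pose Y x : n.-tuple vertex := sval (cid (site_surj n0 (Xz x))).
have YE x : site (Y x) = z - site (X x) by exact: svalP (cid (site_surj n0 (Xz x))).
have inj : injective (fun x => (X x, Y x)).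
  by move=> x x' /(congr1 fst) /(congr1 val) /= /rcons_inj [/val_inj].
have -> : ((2 ^ d) ^ m.-1)%N = #|{: m.-1.-tuple vertex}|.
  by rewrite card_tuple card_ffun card_bool card_ord.
rewrite -(card_imset _ inj); apply: subset_leq_card; apply/fintype.subsetP => u.
by move=> /imsetP[x _ ->]; rewrite inE /sigma /= YE addrC subrK.
Qed.

Lemma fiber_le z : (#|[pred u | sigma u == z]| <= (2 ^ d) ^ m)%N.
Proof.
have inj : {in [pred u | sigma u == z] &, injective (fun u => u.1)}.
  move=> [x y] [x' y'] /eqP /= <- /eqP + /= xx'; rewrite xx' /sigma /= => /addrI.
  by move/site_inj ->.
rewrite -(card_in_imset inj); apply: leq_trans (max_card _) _.
by rewrite card_tuple card_ffun card_bool card_ord.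
Qed.

(** Once the target [z] is fixed, a pair is determined by either of its leaves,
    and the two displacements add up to [sigma u - z]. *)
Lemma fiber_convolution u z :
  1 < 2 ^+ d * p -> 1 < 2 ^+ d * q -> 2 ^+ d * (p * q) < 1 ->
  \sum_(v | sigma v == z)
     p ^+ lev (site u.1 - site v.1) * q ^+ lev (site u.2 - site v.2)
  <= convolution_cst d p q * (2 ^+ d * (p * q)) ^+ lev (sigma u - z).
Proof.
move=> p1 q1 r1; rewrite (big_sub [pred v | sigma v == z]) /=.
pose X := {v : pair | v \in [pred v | sigma v == z]}.
have := @convolution_le R d X (fun v : X => site u.1 - site (sval v).1)
  (fun v : X => site u.2 - site (sval v).2) (sigma u - z) p q.
have vz (v v' : X) : site (sval v).1 + site (sval v).2 = site (sval v').1 + site (sval v').2.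
  by transitivity z; [exact: eqP (svalP v) | exact: esym (eqP (svalP v'))].
have pair_eq (v v' : X) : (sval v).1 = (sval v').1 -> (sval v).2 = (sval v').2 -> v = v'.
  move=> e1 e2; apply: val_inj; rewrite /= [LHS]surjective_pairing e1 e2.
  by rewrite -surjective_pairing.
apply=> //.
- move=> v v' /addrI /oppr_inj /site_inj e1; apply: pair_eq => //.
  by have := vz v v'; rewrite e1 => /addrI /site_inj.
- move=> v v' /addrI /oppr_inj /site_inj e2; apply: pair_eq => //.
  by have := vz v v'; rewrite e2 => /addIr /site_inj.
- move=> v; rewrite addrACA -opprD; congr (_ - _).
  exact: esym (eqP (svalP v)).
Qed.

(** The second moment method in the form used below: optimizing over [t] replaces
    the Cauchy-Schwarz inequality for expectations. *)
Lemma quadratic_bound (a b P : R) : 0 < a -> 0 <= b ->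
  (forall t, 0 <= t -> t * a *+ 2 <= t ^+ 2 * b + P) -> a ^+ 2 <= P * b.
Proof.
move=> a0; rewrite le_eqVlt => /predU1P[<-|b0] H.
  have P0 : 0 <= P by have := H 0 (lexx 0); lra.
  have := H ((P + 1) / a) (divr_ge0 (addr_ge0 P0 ler01) (ltW a0)).
  by rewrite mulr0 add0r divfK ?gt_eqF //; lra.
have := H (a / b) (divr_ge0 (ltW a0) (ltW b0)).
have e1 : a / b * a * b = a ^+ 2 by field; rewrite gt_eqF.
have e2 : (a / b) ^+ 2 * b * b = a ^+ 2 by field; rewrite gt_eqF.
rewrite -(ler_pM2r b0) mulrnAl mulrDl e1 e2; lra.
Qed.

(** Second moment method for the number of surviving pairs above [A], weighted by
    [mu]. The first moment is controlled by [fiber_ge], the second one by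
    [live2_le] and [fiber_convolution], which produce the energy of [mu]. *)
Lemma hits_lower (A : {fset 'rV[int]_d}) (mu : 'rV[int]_d -> R)
    (kern : 'rV[int]_d -> R) (D : R) :
  1 < 2 ^+ d * p -> 1 < 2 ^+ d * q -> 2 ^+ d * (p * q) < 1 ->
  [set` A] `<=` box n -> prob_on A mu -> 0 <= D ->
  (forall z, (2 ^+ d * (p * q)) ^+ lev z <= D * kern z) ->
  (2 ^+ d * p) ^+ m * q ^+ n <=
  4 ^+ d * convolution_cst d p q * D *
  (expect w (coins d n) (fun o => (hits m n A o)%:R) (fun=> false) *
   \sum_(x <- A) \sum_(y <- A) mu x * mu y * kern (x - y)).
Proof.
move=> p1 q1 r1 Abox [mu0 mu1] D0 hkern.
have [p0 _] := andP p01; have [q0 _] := andP q01.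
set EE := \sum_(x <- A) _; set Pr := expect _ _ _ _.
have C0 : 0 < convolution_cst d p q by apply: convolution_cst_gt0.
have pq0 : 0 < p ^+ m * q ^+ n by rewrite mulr_gt0 ?exprn_gt0.
pose S o := \sum_(u | sigma u \in A) mu (sigma u) * (live u o)%:R.
pose Ex f := expect w (coins d n) f (fun=> false).
have ES : p ^+ m * q ^+ n * ((2 ^ d) ^ m.-1)%N%:R <= Ex S.
  rewrite /Ex expect_sum; under eq_bigr do rewrite expectZ live_law.
  rewrite -mulr_suml [leRHS]mulrC ler_wpM2l ?(ltW pq0) //.
  rewrite (sum_fiber A (fun z _ => mu z)).
  apply: (@le_trans _ _ (\sum_(z <- A) mu z * ((2 ^ d) ^ m.-1)%N%:R)).
    by rewrite -mulr_suml mu1 mul1r.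
  rewrite big_seq [leRHS]big_seq; apply: ler_sum => z zA.
  rewrite sumr_const -[leRHS]mulr_natr ler_wpM2l ?mu0 // ler_nat.
  by apply: fiber_ge; apply: Abox.
pose h x := \sum_(z <- A) mu z * (convolution_cst d p q * (D * kern (x - z))).
have h0 x : 0 <= h x.
  rewrite /h big_seq; apply: sumr_ge0 => z zA; rewrite mulr_ge0 ?mu0 //.
  rewrite mulr_ge0 ?(ltW C0) //; apply: le_trans (hkern _).
  by rewrite exprn_ge0 // !mulr_ge0 ?exprn_ge0 ?ltW.
have hE : convolution_cst d p q * D * EE = \sum_(x <- A) mu x * h x.
  rewrite mulr_sumr; apply: eq_bigr => x _; rewrite !mulr_sumr.
  by apply: eq_bigr => z _; ring.
have E0 : 0 <= convolution_cst d p q * D * EE.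
  by rewrite hE big_seq; apply: sumr_ge0 => x xA; rewrite mulr_ge0 ?mu0.
have ES2 : Ex (fun o => S o ^+ 2) <=
    p ^+ m * q ^+ n * ((2 ^ d) ^ m)%N%:R * (convolution_cst d p q * D * EE).
  rewrite /Ex (eq_expect _ _ _ (g := fun o => \sum_(u | sigma u \in A)
     \sum_(v | sigma v \in A) (mu (sigma u) * mu (sigma v)) *
        ((live u o)%:R * (live v o)%:R))); last first.
    move=> o; rewrite expr2 /S big_distrlr /=.
    by apply: eq_bigr => u _; apply: eq_bigr => v _; rewrite mulrACA.
  rewrite expect_sum.
  apply: (@le_trans _ _ (\sum_(u | sigma u \in A)
      (p ^+ m * q ^+ n) * (mu (sigma u) * h (sigma u)))).
    apply: ler_sum => u uA; rewrite expect_sum.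
    under eq_bigr do rewrite expectZ -mulrA.
    rewrite -mulr_sumr [leRHS]mulrCA ler_wpM2l ?mu0 //.
    apply: (@le_trans _ _ (\sum_(v | sigma v \in A) mu (sigma v) * (p ^+ m * q ^+ n *
       (p ^+ lev (site u.1 - site v.1) * q ^+ lev (site u.2 - site v.2))))).
      by apply: ler_sum => v vA; rewrite ler_wpM2l ?mu0 ?live2_le.
    rewrite (sum_fiber A (fun z v => mu z * (p ^+ m * q ^+ n *
       (p ^+ lev (site u.1 - site v.1) * q ^+ lev (site u.2 - site v.2))))).
    rewrite mulr_sumr big_seq [leRHS]big_seq; apply: ler_sum => z zA.
    rewrite -mulr_sumr [leRHS]mulrCA ler_wpM2l ?mu0 // -mulr_sumr.
    rewrite ler_wpM2l ?(ltW pq0) //; apply: le_trans (fiber_convolution _ _ _ _ _) _ => //.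
    by rewrite ler_wpM2l ?(ltW C0).
  rewrite -mulr_sumr -[leRHS]mulrA ler_wpM2l ?(ltW pq0) //.
  rewrite hE (sum_fiber A (fun z _ => mu z * h z)) mulr_sumr.
  rewrite big_seq [leRHS]big_seq; apply: ler_sum => z zA.
  by rewrite sumr_const -[leLHS]mulr_natl ler_wpM2r ?mulr_ge0 ?mu0 ?ler_nat ?fiber_le.
have key t : 0 <= t ->
    t * (p ^+ m * q ^+ n * ((2 ^ d) ^ m.-1)%N%:R) *+ 2 <=
    t ^+ 2 * (p ^+ m * q ^+ n * ((2 ^ d) ^ m)%N%:R * (convolution_cst d p q * D * EE)) + Pr.
  move=> t0; apply: (@le_trans _ _ (Ex (fun o => t ^+ 2 * S o ^+ 2 + (hits m n A o)%:R))).
    apply: (@le_trans _ _ (Ex (fun o => (t *+ 2) * S o))).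
      by rewrite /Ex expectZ mulrnAl lerMn2r ler_wpM2l.
    apply: le_expect => [|o]; first exact: coin_wt01.
    rewrite hitsE; case: existsP => [_|no].
      by rewrite -subr_ge0; have := sqr_ge0 (t * S o - 1); rewrite !expr2 mulr1n; nra.
    have -> : S o = 0.
      rewrite /S big1 // => u uA; case: (boolP (live u o)) => [lu|]; last by rewrite mulr0.
      by case: no; exists u; rewrite uA.
    by rewrite expr0n /= !mulr0 addr0.
  by rewrite /Ex expectD expectZ lerD2r ler_wpM2l ?sqr_ge0.
have : (p ^+ m * q ^+ n * ((2 ^ d) ^ m.-1)%N%:R) ^+ 2
    <= Pr * (p ^+ m * q ^+ n * ((2 ^ d) ^ m)%N%:R * (convolution_cst d p q * D * EE)).
  apply: quadratic_bound key; first by rewrite mulr_gt0 ?ltr0n ?expn_gt0.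
  by rewrite mulr_ge0 // mulr_ge0 ?(ltW pq0).
set X := p ^+ m * q ^+ n; set CE := convolution_cst d p q * D * EE.
set M1 := ((2 ^ d) ^ m.-1)%N%:R.
have M1_gt0 : 0 < M1 :> R by rewrite ltr0n !expn_gt0.
have -> : ((2 ^ d) ^ m)%N%:R = 2 ^+ d * M1 :> R.
  by rewrite -[in LHS](prednK m_gt0) expnS natrM natrX.
have X0 : 0 < X * M1 by rewrite mulr_gt0.
have -> : (2 ^+ d * p) ^+ m * q ^+ n = 2 ^+ d * (X * M1).
  by rewrite exprMn -[in LHS](prednK m_gt0) exprS /M1 natrX natrX /X (prednK m_gt0); ring.
have -> : 4 ^+ d = 2 ^+ d * 2 ^+ d :> R by rewrite -exprMn -natrM.
have t0 : 0 < 2 ^+ d :> R by rewrite exprn_gt0.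
move: (2 ^+ d) t0 => t t0 H; rewrite -(ler_pM2r X0).
have := ler_wpM2l (ltW t0) H; rewrite /CE; lra.
Qed.

End LeafPairs.

(** * Unions of increasing events and the Schur test *)

Section Unions.
Variables (R : realFieldType) (K : eqType) (w : K -> R).
Hypothesis w01 : forall a, 0 <= w a <= 1.

(** The complements of increasing events are positively correlated by Harris'
    inequality, so a union is at most as likely as if the events were
    independent. *)
Lemma expect_or s (F G : (K -> bool) -> bool) o :
  (forall o o', (forall a, o a ==> o' a) -> F o ==> F o') ->
  (forall o o', (forall a, o a ==> o' a) -> G o ==> G o') ->
  expect w s (fun o => (F o || G o)%:R) o <=
  expect w s (fun o => (F o)%:R) o + expect w s (fun o => (G o)%:R) o
  - expect w s (fun o => (F o)%:R) o * expect w s (fun o => (G o)%:R) o.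
Proof.
move=> mF mG; pose e (H : (K -> bool) -> bool) := expect w s (fun o => (H o)%:R) o.
rewrite -/(e F) -/(e G) -/(e (fun o => F o || G o)).
have anti H : (forall o o', (forall a, o a ==> o' a) -> H o ==> H o') ->
    antitone (fun o : K -> bool => 1 + -1 * (H o : bool)%:R : R).
  move=> mH o1 o2 o12; have := mH _ _ o12; rewrite lerD2l !mulN1r lerN2 ler_nat.
  by case: (H o1) => //= ->.
have := harris w01 s o (anti _ mF) (anti _ mG).
have E H : expect w s (fun o => 1 + -1 * (H o : bool)%:R) o = 1 - e H.
  by rewrite expectD expectZ expect_cst mulN1r.
rewrite !E (@eq_expect _ _ _ _ _ (fun o => 1 + -1 * (F o || G o)%:R)); last first.
  by move=> o'; case: (F o'); case: (G o') => /=; rewrite ?mulr1n ?mulr0n; ring.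
by rewrite (E (fun o => F o || G o)); lra.
Qed.

End Unions.

Section Schur.
Variables (R : realFieldType) (U V : finType) (pi : U -> V) (nu : U -> R).

Lemma sum_classes (H : V -> V -> R) :
  \sum_u \sum_v nu u * nu v * H (pi u) (pi v) =
  \sum_a \sum_b (\sum_(u | pi u == a) nu u) * (\sum_(v | pi v == b) nu v) * H a b.
Proof.
rewrite (partition_big pi predT) //=; apply: eq_bigr => a _.
under eq_bigr => u _ do rewrite (partition_big pi predT) //=.
rewrite exchange_big /=; apply: eq_bigr => b _.
rewrite big_distrlr /= mulr_suml; apply: eq_bigr => u /eqP ->.
by rewrite mulr_suml; apply: eq_bigr => v /eqP ->.
Qed.

(** The Schur test: bound [g a * g b] by the mean of the squares and count the
    neighbours of each class. *)
Lemma schur (r : rel V) (D : nat) : symmetric r ->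
  (forall a, #|r a| <= D)%N ->
  \sum_u \sum_v nu u * nu v * (r (pi u) (pi v))%:R <=
  D%:R * \sum_u \sum_v nu u * nu v * (pi u == pi v)%:R.
Proof.
move=> sr rD; rewrite (sum_classes (fun a b => (r a b)%:R)).
rewrite (sum_classes (fun a b => (a == b)%:R)).
set g := fun a => \sum_(u | pi u == a) nu u.
have -> : \sum_a \sum_b g a * g b * (a == b)%:R = \sum_a g a ^+ 2.
  apply: eq_bigr => a _; rewrite (bigD1 a) //= eqxx mulr1 big1 ?addr0 // => b.
  by rewrite eq_sym => /negbTE ->; rewrite mulr0.
have sumr a : \sum_b (r a b)%:R <= D%:R :> R.
  rewrite -natr_sum ler_nat; apply: leq_trans (rD a).
  by rewrite -sum1_card [leqRHS]big_mkcond.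
apply: (@le_trans _ _ (2^-1 * (\sum_a \sum_b g a ^+ 2 * (r a b)%:R
                               + \sum_a \sum_b g b ^+ 2 * (r a b)%:R))).
  rewrite mulrDr !mulr_sumr -big_split; apply: ler_sum => a _ /=.
  rewrite !mulr_sumr -big_split; apply: ler_sum => b _ /=.
  rewrite -!mulrDr -mulrDl mulrA ler_wpM2r ?ler0n //.
  have := sqr_ge0 (g a - g b); rewrite -/(g a) -/(g b); move: (g a) (g b) => x y; nra.
have -> : \sum_a \sum_b g b ^+ 2 * (r a b)%:R = \sum_a \sum_b g a ^+ 2 * (r a b)%:R.
  by rewrite exchange_big; apply: eq_bigr => a _; apply: eq_bigr => b _; rewrite sr.
suff h : \sum_a \sum_b g a ^+ 2 * (r a b)%:R <= D%:R * \sum_a g a ^+ 2 by lra.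
rewrite mulr_sumr; apply: ler_sum => a _.
by rewrite -mulr_sumr mulrC ler_wpM2r ?sqr_ge0.
Qed.

End Schur.

(** * The pair tree and the upper bound *)

Section Upper.
Variables (R : realType) (d : nat) (p q : R) (m n : nat).
Hypotheses (p01 : 0 < p < 1) (q01 : 0 < q < 1) (m_gt0 : (0 < m)%N) (mn : (m <= n)%N).
Variable A : {fset 'rV[int]_d}.
Local Notation vertex := {ffun 'I_d -> bool}.
Local Notation pair := (m.-tuple vertex * n.-tuple vertex)%type.
Local Notation config := (address d + address d -> bool).
Local Notation w := (coin_wt (d := d) p q).
Implicit Types (u v l : pair) (o : config) (nu : pair -> R).

Let p_gt0 : 0 < p. Proof. by case/andP: p01. Qed.
Let q_gt0 : 0 < q. Proof. by case/andP: q01. Qed.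
Let q_lt1 : q < 1. Proof. by case/andP: q01. Qed.


(** Nodes of the pair tree at height [k] are represented by the pairs of leaves
    below them. As [drop] empties addresses that are too short, nodes of height
    [m] or more only record the second address, so the first [n - m] generations
    split in the second tree alone. *)
Definition same k u v : bool :=
  (drop k u.1 == drop k v.1) && (drop k u.2 == drop k v.2).

Lemma same_refl k u : same k u u. Proof. by rewrite /same !eqxx. Qed.

Lemma same_sym k u v : same k u v = same k v u.
Proof. by rewrite /same eq_sym [X in _ && X]eq_sym. Qed.

Lemma same_trans k u v l : same k u v -> same k v l -> same k u l.
Proof. by rewrite /same => /andP[/eqP -> /eqP ->]. Qed.

Lemma same_le k j u v : (k <= j)%N -> same k u v -> same j u v.
Proof.
by move=> kj /andP[/eqP e1 /eqP e2]; rewrite /same -(subnK kj) -!drop_drop e1 e2 !eqxx.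
Qed.

Lemma same0 u v : same 0 u v = (u == v).
Proof. by rewrite /same !drop0 !val_eqE -xpair_eqE -!surjective_pairing. Qed.

Lemma same_top u v : same n u v.
Proof. by rewrite /same !drop_oversize ?size_tuple. Qed.

(** The edge from the node of height [j] above [u] to its parent is open; in the
    first [n - m] generations it carries a coin of the second tree only. *)
Definition step j u o : bool :=
  ((j < m)%N ==> o (inl (drop j u.1))) && o (inr (drop j u.2)).

Definition open_path j u o : bool := all (fun i => step i u o) (iota 0 j).

Lemma open_pathS j u o : open_path j.+1 u o = open_path j u o && step j u o.
Proof. by rewrite /open_path -addn1 iotaD all_cat /= andbT. Qed.

(** Some pair with sum in [A] below the node of height [j] above [u] is joined to
    that node by open edges. *)
Definition survives j u o : bool :=
  [exists v, [&& same j u v, open_path j v o & sigma v \in A]].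

Lemma live_open_path u o : live u o -> open_path n u o.
Proof.
rewrite /live !alive_drop !size_tuple => /andP[/allP h1 /allP h2].
apply/allP => i; rewrite mem_iota => hi; apply/andP; split.
  by apply/implyP => im; apply: h1; apply: map_f; rewrite mem_iota.
by apply: h2; apply: map_f; rewrite mem_iota.
Qed.

Lemma hits_survives u o : hits m n A o -> survives n u o.
Proof.
rewrite hitsE => /existsP[v /andP[vA /live_open_path hv]].
by apply/existsP; exists v; rewrite same_top hv vA.
Qed.

Lemma step_mono j u o o' : (forall a, o a ==> o' a) -> step j u o ==> step j u o'.
Proof.
move=> oo'; apply/implyP => /andP[/implyP h1 h2]; apply/andP; split.
  by apply/implyP => /h1; apply: implyP.
by apply: implyP h2.
Qed.

Lemma survives_mono j u o o' : (forall a, o a ==> o' a) ->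
  survives j u o ==> survives j u o'.
Proof.
move=> oo'; apply/implyP => /existsP[v /and3P[h1 /allP h2 h3]].
apply/existsP; exists v; rewrite h1 h3 andbT; apply/allP => i /h2.
by apply/implyP/step_mono.
Qed.

Lemma step_same j u v o : same j u v -> step j u o = step j v o.
Proof. by move=> /andP[/eqP e1 /eqP e2]; rewrite /step e1 e2. Qed.

Lemma survives_same j u v o : same j u v -> survives j u o = survives j v o.
Proof.
move=> uv; apply/existsP/existsP => -[l /and3P[h1 h2 h3]]; exists l; rewrite h2 h3 !andbT.
  by apply: same_trans h1; rewrite same_sym.
exact: same_trans h1.
Qed.

Definition theta j : R := if (j < m)%N then p * q else q.
(** The probability that a leaf is joined to its ancestor of height [j], and hence
    the decay of the tree kernel. *)
Definition kappa j : R := p ^+ minn j m * q ^+ j.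

Lemma kappaS j : kappa j.+1 = theta j * kappa j.
Proof.
rewrite /kappa /theta; case: ltnP => jm.
  by rewrite (minn_idPl jm) !exprS mulrACA.
by rewrite (minn_idPr (leqW jm)) exprS mulrCA.
Qed.

Lemma kappa_gt0 j : 0 < kappa j.
Proof. by rewrite mulr_gt0 ?exprn_gt0. Qed.

Lemma theta_gt0 j : 0 < theta j.
Proof. by rewrite /theta; case: ifP; rewrite ?mulr_gt0. Qed.

Lemma theta_le j : theta j <= q.
Proof.
by rewrite /theta; case: ifP => // _; have [_ p_lt] := andP p01; rewrite ler_piMl ?ltW.
Qed.

Lemma kappa_le j k : (j <= k)%N -> kappa k <= kappa j * q ^+ (k - j).
Proof.
elim: k => [|k IH]; first by rewrite leqn0 => /eqP ->; rewrite subnn mulr1.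
rewrite leq_eqVlt ltnS => /predU1P[->|jk]; first by rewrite subnn mulr1.
rewrite kappaS subSn // exprS [leRHS]mulrCA.
apply: ler_pM (IH jk); rewrite ?(ltW (theta_gt0 _)) ?(ltW (kappa_gt0 _)) //.
exact: theta_le.
Qed.

Lemma survives_indep j u c :
  (forall v i, (i < j)%N -> (i < m)%N -> c != inl (drop i v.1)) ->
  (forall v i, (i < j)%N -> c != inr (drop i v.2)) ->
  indep_of c (fun o => (survives j u o)%:R : R).
Proof.
move=> h1 h2 o b; congr (_%:R); congr nat_of_bool; apply: eq_existsb => v.
congr [&& _, _ & _]; apply: eq_in_all => i; rewrite mem_iota => /= ij.
rewrite /step; congr (_ && _); last by rewrite upd_other // eq_sym h2.
by case: (ltnP i m) => //= im; rewrite upd_other // eq_sym h1.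
Qed.

Definition coin_prob (F : config -> bool) : R :=
  expect w (coins d n) (fun o => (F o)%:R) (fun=> false).

Lemma mem_coins_inl j u : (j < m)%N -> inl (drop j u.1) \in coins d n.
Proof.
move=> jm; rewrite mem_cat map_f // mem_nodes size_drop size_tuple; lia.
Qed.

Lemma mem_coins_inr j u : (j < n)%N -> inr (drop j u.2) \in coins d n.
Proof.
move=> jn; rewrite mem_cat orbC map_f // mem_nodes size_drop size_tuple; lia.
Qed.

Lemma uniq_coins : uniq (coins d n).
Proof.
rewrite cat_uniq !map_inj_uniq ?undup_uniq //=; try by move=> ? ? [].
by rewrite andbT; apply/hasPn => c /mapP[b _ ->]; apply/negP => /mapP[].
Qed.

Lemma step_survives j u : (j < n)%N ->
  coin_prob (fun o => step j u o && survives j u o) = theta j * coin_prob (survives j u).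
Proof.
move=> jn.
have indr : indep_of (inr (drop j u.2)) (fun o => (survives j u o)%:R : R).
  apply: survives_indep => // v i ij; apply/eqP => -[] /(congr1 size).
  by rewrite !size_drop !size_tuple; lia.
rewrite /coin_prob /theta /step; case: (ltnP j m) => jm /=; last first.
  rewrite -[RHS](expect_coin w (fun=> false) uniq_coins (mem_coins_inr u jn) indr).
  by apply: eq_expect => o; rewrite -natrM mulnb.
have indl : indep_of (inl (drop j u.1)) (fun o => (survives j u o)%:R : R).
  apply: survives_indep => // v i ij im; apply/eqP => -[] /(congr1 size).
  by rewrite !size_drop !size_tuple; lia.
rewrite -mulrA -[q * _](expect_coin w (fun=> false) uniq_coins (mem_coins_inr u jn) indr).
rewrite -[p * _](expect_coin w (fun=> false) uniq_coins (mem_coins_inl u jm)).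
  by apply: eq_expect => o; rewrite -!natrM !mulnb andbA.
by move=> o b; rewrite indl upd_other.
Qed.

Definition mass nu : R := \sum_u nu u.
Definition overlap k nu nu' : R := \sum_u \sum_v nu u * nu' v * (same k u v)%:R.
(** The energy form of the pair tree: the kernel at two leaves that meet at height
    [j] is the tail [\sum_(k >= j) kappa k], which is comparable to [kappa j]. *)
Definition pair_form nu nu' : R := \sum_(0 <= k < n.+1) kappa k * overlap k nu nu'.

Lemma overlap_comb k nu nu' (t : R) :
  let f := fun u => nu u + t * nu' u in
  overlap k f f = overlap k nu nu + t *+ 2 * overlap k nu nu' + t ^+ 2 * overlap k nu' nu'.
Proof.
rewrite /=.
have S : overlap k nu' nu = overlap k nu nu'.
  rewrite /overlap exchange_big; apply: eq_bigr => u _; apply: eq_bigr => v _.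
  by rewrite same_sym; ring.
rewrite mulr2n mulrDl -{2}S /overlap !mulr_sumr -!big_split; apply: eq_bigr => u _ /=.
by rewrite !mulr_sumr -!big_split; apply: eq_bigr => v _ /=; ring.
Qed.

Lemma pair_form_comb nu nu' (t : R) :
  let f := fun u => nu u + t * nu' u in
  pair_form f f = pair_form nu nu + t *+ 2 * pair_form nu nu' + t ^+ 2 * pair_form nu' nu'.
Proof.
rewrite /= /pair_form !mulr_sumr -!big_split; apply: eq_bigr => k _ /=.
by rewrite overlap_comb; ring.
Qed.

Lemma pair_form_scale nu (t : R) :
  pair_form (fun u => t * nu u) (fun u => t * nu u) = t ^+ 2 * pair_form nu nu.
Proof.
rewrite /pair_form mulr_sumr; apply: eq_bigr => k _; rewrite mulrCA; congr (_ * _).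
rewrite /overlap !mulr_sumr; apply: eq_bigr => u _; rewrite mulr_sumr.
by apply: eq_bigr => v _; ring.
Qed.

(** Measures carried by different nodes of height below [j] interact only through
    the levels from [j] on, whose weights decay geometrically. *)
Lemma pair_form_separated j nu nu' : (j <= n)%N ->
  (forall u, 0 <= nu u) -> (forall u, 0 <= nu' u) ->
  (forall k u v, (k < j)%N -> nu u != 0 -> nu' v != 0 -> ~~ same k u v) ->
  pair_form nu nu' <= kappa j / (1 - q) * (mass nu * mass nu').
Proof.
move=> jn nu0 nu0' sep.
rewrite /pair_form (@big_cat_nat _ _ _ j) //=; last exact: leqW.
rewrite [X in X + _]big_nat big1 ?add0r => [|k /andP[_ kj]]; last first.
  rewrite /overlap big1 ?mulr0 // => u _; rewrite big1 // => v _.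
  have [->|nu1] := eqVneq (nu u) 0; first by rewrite !mul0r.
  have [->|nv1] := eqVneq (nu' v) 0; first by rewrite mulr0 mul0r.
  by rewrite (negbTE (sep _ _ _ kj nu1 nv1)) mulr0.
have M0 : 0 <= mass nu * mass nu' by rewrite mulr_ge0 ?sumr_ge0.
apply: (@le_trans _ _ (\sum_(j <= k < n.+1) kappa j * q ^+ (k - j) * (mass nu * mass nu'))).
  apply: ler_sum_nat => k /andP[jk _]; apply: ler_pM; rewrite ?(ltW (kappa_gt0 _)) ?kappa_le //.
    by apply: sumr_ge0 => u _; apply: sumr_ge0 => v _; rewrite !mulr_ge0.
  rewrite /mass big_distrlr /=; apply: ler_sum => u _; apply: ler_sum => v _.
  by rewrite ler_piMr ?mulr_ge0 //; case: (same k u v).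
rewrite -mulr_suml ler_wpM2r // -mulr_sumr ler_wpM2l ?(ltW (kappa_gt0 _)) //.
rewrite -{1}[j]add0n big_addn; under eq_bigr do rewrite addnK.
by apply: le_trans (geometric_le 0 _ _) _; rewrite ?mul1r // q_lt1 ltW.
Qed.

Definition energy_cst : R := 2 / (1 - q).

(** The invariant of the recursion. The mass of [nu] is an upper bound for the
    probability of [F], and the energy is linear, not quadratic, in the mass:
    after normalization this bounds the probability by the inverse energy. *)
Definition admissible (S : pair -> bool) (F : config -> bool) (t : R) nu : Prop :=
  [/\ forall v, 0 <= nu v, forall v, nu v != 0 -> S v && (sigma v \in A),
      mass nu <= 1, coin_prob F <= mass nu & pair_form nu nu <= energy_cst * t * mass nu].

Lemma admissible_leaf u : exists nu, admissible (same 0 u) (survives 0 u) (kappa 0) nu.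
Proof.
pose nu v : R := ((v == u) && (sigma u \in A))%:R.
have nu0 v : 0 <= nu v by rewrite ler0n.
have mnu : mass nu = (sigma u \in A)%:R.
  rewrite /mass (bigD1 u) //= big1 ?addr0 /nu ?eqxx // => v /negbTE vu.
  by rewrite vu.
exists nu; split => //.
- move=> v; rewrite /nu; case: (eqVneq v u) => [->|_]; last by rewrite eqxx.
  by rewrite same_refl; case: (_ \in A) => //; rewrite eqxx.
- by rewrite mnu; case: (_ \in A).
- rewrite mnu /coin_prob -[leRHS](expect_cst w (coins d n) _ (fun=> false)).
  apply: le_expect => [|o]; first exact: coin_wt01.
  rewrite ler_nat; case: (boolP (survives 0 u o)) => // /existsP[v /and3P[]].
  by rewrite same0 => /eqP <- _ ->.
- apply: le_trans (pair_form_separated (j := 0) _ _ _ _) _ => //.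
  rewrite mnu -natrM mulnb andbb ler_wpM2r ?ler0n // /energy_cst.
  rewrite [leRHS]mulrC mulrA ler_wpM2r ?invr_ge0 ?subr_ge0 ?(ltW q_lt1) //.
  by apply: ler_peMr; rewrite ?ler1n // ltW ?kappa_gt0.
Qed.

Lemma admissible_step j u : (j < n)%N ->
  (exists nu, admissible (same j u) (survives j u) (kappa j) nu) ->
  exists nu, admissible (same j u) (fun o => step j u o && survives j u o) (kappa j.+1) nu.
Proof.
move=> jn [nu [nu0 supp m1 hE hB]]; have t0 := theta_gt0 j.
have M : mass (fun v => theta j * nu v) = theta j * mass nu by rewrite /mass mulr_sumr.
exists (fun v => theta j * nu v); split.
- by move=> v; rewrite mulr_ge0 ?(ltW t0).
- by move=> v; rewrite mulf_eq0 negb_or => /andP[_ /supp].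
- rewrite M mulr_ile1 ?(ltW t0) //; first exact: sumr_ge0.
  exact: le_trans (theta_le j) (ltW q_lt1).
- by rewrite M step_survives // ler_wpM2l ?(ltW t0).
- rewrite M pair_form_scale kappaS.
  have := ler_wpM2l (sqr_ge0 (theta j)) hB; move/le_trans; apply.
  by rewrite le_eqVlt; apply/orP; left; apply/eqP; ring.
Qed.

(** The event that one child or another succeeds. If the masses are [a] and [b],
    the combination [nu1 + (1 - a) nu2] has mass [a + b - a b], which is the bound
    of [expect_or]. Its energy is at most
    [c (a + (1 - a) a b + (1 - a)^2 b) = c (a + (1 - a) b)], with [c] the product
    of [energy_cst] and [kappa j.+1], so the linear bound on the energy persists
    with the same constant. The factor 2 in [energy_cst] absorbs the two cross
    terms. *)
Lemma admissible_union j l (S : pair -> bool) (F : config -> bool) nu1 nu2 :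
  (j < n)%N ->
  (forall o o', (forall a, o a ==> o' a) -> F o ==> F o') ->
  (forall v v', same j l v -> S v' -> ~~ same j v v') ->
  admissible (same j l) (fun o => step j l o && survives j l o) (kappa j.+1) nu1 ->
  admissible S F (kappa j.+1) nu2 ->
  exists nu, admissible (fun v => same j l v || S v)
    (fun o => (step j l o && survives j l o) || F o) (kappa j.+1) nu.
Proof.
move=> jn mF sep [nu10 supp1 a1 hE1 hB1] [nu20 supp2 b1 hE2 hB2].
set a := mass nu1 in a1 hE1 hB1; set b := mass nu2 in b1 hE2 hB2.
have a0 : 0 <= a by apply: sumr_ge0.
have b0 : 0 <= b by apply: sumr_ge0.
pose nu v := nu1 v + (1 - a) * nu2 v.
have c0 : 0 <= 1 - a by rewrite subr_ge0.
have M : mass nu = a + (1 - a) * b by rewrite /mass big_split -mulr_sumr.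
exists nu; split.
- by move=> v; rewrite addr_ge0 ?mulr_ge0.
- move=> v; have [z1|/supp1 /andP[-> ->] //] := eqVneq (nu1 v) 0.
  rewrite /nu z1 add0r mulf_eq0 negb_or => /andP[_ /supp2 /andP[-> ->]].
  by rewrite orbT.
- by rewrite M; nra.
- have mSE : forall o o' : config, (forall a, o a ==> o' a) ->
      (step j l o && survives j l o) ==> (step j l o' && survives j l o').
    move=> o o' oo'; apply/implyP => /andP[h1 h2].
    by rewrite (implyP (step_mono j l oo') h1) (implyP (survives_mono j l oo') h2).
  have := expect_or (coin_wt01 p01 q01) (coins d n) (fun=> false) mSE mF.
  rewrite -[X in _ <= X + _ - X * _]/(coin_prob (fun o => step j l o && survives j l o)).
  rewrite -[X in _ <= _ + X - _ * X]/(coin_prob F) M => H; apply: le_trans H _.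
  have x1 := le_trans hE1 a1; move: hE1 hE2 x1.
  move: (coin_prob _) (coin_prob _) => y x hx hy x1.
  have : 0 <= (1 - x) * (b - y) by rewrite mulr_ge0 ?subr_ge0.
  have : 0 <= (1 - b) * (a - x) by rewrite mulr_ge0 ?subr_ge0.
  lra.
- have cross : pair_form nu1 nu2 <= kappa j.+1 / (1 - q) * (a * b).
    apply: pair_form_separated => // k u v kj /supp1 /andP[h1 _] /supp2 /andP[h2 _].
    by apply: contra (sep _ _ h1 h2); apply: same_le; rewrite -ltnS.
  rewrite pair_form_comb M.
  have H1 : (1 - a) *+ 2 * pair_form nu1 nu2 <= (1 - a) * (energy_cst * kappa j.+1 * (a * b)).
    rewrite mulrnAl -mulrnAr ler_wpM2l // -mulr_natl.
    have := ler_wpM2l (ler0n R 2) cross; rewrite /energy_cst.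
    by move/le_trans; apply; rewrite le_eqVlt; apply/orP; left; apply/eqP; ring.
  have H2 := ler_wpM2l (sqr_ge0 (1 - a)) hB2.
  apply: le_trans (lerD (lerD hB1 H1) H2) _.
  by rewrite le_eqVlt; apply/orP; left; apply/eqP; ring.
Qed.

Lemma eq_admissible (S S' : pair -> bool) (F F' : config -> bool) (t : R) nu :
  (forall v, S v -> S' v) -> (forall o, F' o -> F o) ->
  admissible S F t nu -> admissible S' F' t nu.
Proof.
move=> SS' FF' [h1 h2 h3 h4 h5]; split=> //.
  by move=> v /h2 /andP[/SS' -> ->].
apply: le_trans h4; apply: le_expect => [|o]; first exact: coin_wt01.
by rewrite ler_nat; case: (boolP (F' o)) => // /FF' ->.
Qed.

(** Children are added one pair of leaves at a time; a pair that lies below an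
    already listed child contributes nothing new, which spares the choice of
    representatives. *)
Lemma admissible_children j (L : seq pair) : (j < n)%N ->
  (forall u, exists nu, admissible (same j u) (survives j u) (kappa j) nu) ->
  exists nu, admissible (fun v => has (fun l => same j l v) L)
    (fun o => has (fun l => step j l o && survives j l o) L) (kappa j.+1) nu.
Proof.
move=> jn IH; elim: L => [|l L [nu2 h2]].
  exists (fun=> 0); have M0 : mass (fun=> 0) = 0 by rewrite /mass big1.
  split=> //; rewrite ?M0 ?ler01 ?mulr0 //.
  - by move=> v; rewrite eqxx.
  - by rewrite /coin_prob expect_cst.
  - rewrite /pair_form big1 // => k _; rewrite /overlap big1 ?mulr0 // => u _.
    by rewrite big1 // => v _; rewrite !mul0r.
have [/hasP[l' l'L ll']|nl] := boolP (has (same j l) L).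
  exists nu2; apply: eq_admissible h2 => [v /= -> //|o /=]; first by rewrite orbT.
  move=> /orP[h|//]; apply/hasP; exists l' => //.
  by rewrite -(step_same o ll') -(survives_same o ll').
have [nu1 h1] := admissible_step jn (IH l).
apply: admissible_union h1 h2 => //.
  move=> o o' oo'; apply/implyP => /hasP[l' l'L /andP[h1 h3]]; apply/hasP; exists l' => //.
  by rewrite (implyP (step_mono j l' oo') h1) (implyP (survives_mono j l' oo') h3).
move=> v v' lv /hasP[l' l'L l'v']; apply: contra nl => vv'; apply/hasP; exists l' => //.
by apply: same_trans lv _; apply: same_trans vv' _; rewrite same_sym.
Qed.

Lemma admissible_node j u : (j <= n)%N ->
  exists nu, admissible (same j u) (survives j u) (kappa j) nu.
Proof.
elim: j u => [|j IH] u jn; first exact: admissible_leaf.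
have [nu h] := admissible_children [seq l <- enum {: pair} | same j.+1 u l] jn
  (fun u => IH u (ltnW jn)).
exists nu; apply: eq_admissible h => [v /hasP[l]|o /existsP[v /and3P[h1 h2 h3]]].
  rewrite mem_filter => /andP[ul _] lv; apply: same_trans ul _.
  by apply: same_le lv.
apply/hasP; exists v; first by rewrite mem_filter h1 mem_enum.
move: h2; rewrite open_pathS => /andP[h2 ->]; apply/existsP; exists v.
by rewrite same_refl h2 h3.
Qed.


Lemma divn_near K a b a' b' : (0 < K)%N -> (a + b < a' + b' + K)%N ->
  (a %/ K + b %/ K <= a' %/ K + b' %/ K + 2)%N.
Proof.
move=> K0 h; rewrite leqNgt; apply/negP => far.
have := divn_eq a' K; have := divn_eq b' K.
have := ltn_pmod a' K0; have := ltn_pmod b' K0.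
have := leq_trunc_div a K; have := leq_trunc_div b K.
have := leq_mul far (leqnn K); rewrite !mulSn !mulnDl; lia.
Qed.

(** If the sums of two pairs are within [2 ^ k], the sums of the corners of their
    nodes differ by at most 2 in units of [2 ^ k]. Given one node, the first
    component of the other one is free and its second component has then at most
    5 possible values per coordinate. *)
Lemma overlap_near k nu : (forall u, 0 <= nu u) ->
  \sum_u \sum_v nu u * nu v * (lev (sigma u - sigma v) <= k)%N%:R
  <= (5 ^ d * (2 ^ d) ^ (m - k))%N%:R * overlap k nu nu.
Proof.
move=> nu0; pose V := ((m - k).-tuple vertex * (n - k).-tuple vertex)%type.
pose pi u : V := ([tuple of drop k u.1], [tuple of drop k u.2]).
pose s (a : V) i := (coord a.1 i + coord a.2 i)%N.
pose near : rel V := fun a b => [forall i, (s a i <= s b i + 2) && (s b i <= s a i + 2)]%N.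
have near_sym : symmetric near.
  by move=> a b; apply: eq_forallb => i; rewrite andbC.
have near_card a : (#|near a| <= 5 ^ d * (2 ^ d) ^ (m - k))%N.
  rewrite -sum1_card big_mkcond /=.
  rewrite -(pair_bigA _ (fun x y => if (x, y) \in near a then 1 else 0)%N) /=.
  have -> : ((2 ^ d) ^ (m - k))%N = #|{: (m - k).-tuple vertex}|.
    by rewrite card_tuple card_ffun card_bool card_ord.
  rewrite mulnC -sum_nat_const; apply: leq_sum => x _.
  rewrite -big_mkcond sum1_card.
  pose f (y : (n - k).-tuple vertex) : 'rV[int]_d := \row_i (coord y i)%:Z.
  have injf : injective f.
    move=> y y' /rowP eqf; apply: val_inj; apply: coord_inj; first by rewrite !size_tuple.
    by move=> i; have := eqf i; rewrite !mxE => -[].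
  (* The coordinates of the second component lie in a window of 5 integers. *)
  apply: leq_trans (card_window (fun i => (s a i)%:Z - (coord x i)%:Z - 2) 4 injf).
  apply: subset_leq_card; apply/fintype.subsetP => y; rewrite !inE => /forallP h.
  by apply/forallP => i; have := h i; rewrite /s !mxE /=; lia.
apply: (@le_trans _ _ (\sum_u \sum_v nu u * nu v * (near (pi u) (pi v))%:R)).
  apply: ler_sum => u _; apply: ler_sum => v _.
  rewrite ler_wpM2l ?mulr_ge0 // ler_nat lev_le.
  case: forallP => // h; suff -> : near (pi u) (pi v) by [].
  apply/forallP => i; rewrite /s /= !coord_drop; have := h i.
  have -> : (sigma u - sigma v) 0 i =
      (coord u.1 i + coord u.2 i)%N%:Z - (coord v.1 i + coord v.2 i)%N%:Z.
    by rewrite !mxE !size_tuple !PoszD; ring.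
  move=> hi; apply/andP; split; apply: divn_near; rewrite ?expn_gt0 //; move: hi.
    by move: (coord u.1 i) (coord u.2 i) (coord v.1 i) (coord v.2 i) => a b a' b'; lia.
  by move: (coord u.1 i) (coord u.2 i) (coord v.1 i) (coord v.2 i) => a b a' b'; lia.
apply: le_trans (schur pi nu near_sym near_card) _.
by rewrite ler_wpM2l ?ler0n.
Qed.

(** Addition pushes the tree energy down to the Riesz energy. At scale [k],
    [overlap_near] costs a factor of order [(2 ^ d) ^ (m - k)], and
    [p ^ m * rho ^ k * (2 ^ d) ^ (m - k) = kappa k * (2 ^ d * p) ^ maxn m k], where
    the last factor is at most [G]. *)
Lemma energy_form nu (kern : 'rV[int]_d -> R) (D G : R) :
  (forall u, 0 <= nu u) -> (forall u, nu u != 0 -> sigma u \in A) ->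
  [set` A] `<=` box n -> 0 <= D -> 0 <= G ->
  (forall z, kern z <= D * (2 ^+ d * (p * q)) ^+ lev z) ->
  (forall x y, x \in A -> y \in A -> (2 ^+ d * p) ^+ maxn m (lev (x - y)) <= G) ->
  p ^+ m * \sum_u \sum_v nu u * nu v * kern (sigma u - sigma v)
  <= D * 5 ^+ d * G * pair_form nu nu.
Proof.
move=> nu0 supp Abox D0 G0 hkern hG.
set rho := 2 ^+ d * (p * q) in hkern.
have rho0 : 0 < rho by rewrite !mulr_gt0 ?exprn_gt0.
have lev_n x y : x \in A -> y \in A -> (lev (x - y) <= n)%N.
  move=> /Abox hx /Abox hy; rewrite lev_le; apply/forallP => i.
  have n0 : (0 < n)%N := leq_trans m_gt0 mn.
  have := hx i; have := hy i; rewrite mxE [(- y) _ _]mxE.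
  have -> : (2 ^+ n.-1 : int) = (2 ^ n.-1)%N%:Z by rewrite -natz natrX.
  by rewrite -[in X in (_ < X)%N](prednK n0) expnS; move: (x 0 i) (y 0 i) => a b; lia.
(* Only the levels that occur as [lev (x - y)] with [x, y \in A] may be used, as
   the factor at higher levels is not controlled by [G]. *)
pose ok k := (2 ^+ d * p) ^+ maxn m k <= G.
have pw u v : nu u * nu v * kern (sigma u - sigma v) <=
    D * \sum_(0 <= k < n.+1 | ok k)
      rho ^+ k * (nu u * nu v * (lev (sigma u - sigma v) <= k)%N%:R).
  have [->|nu1] := eqVneq (nu u) 0.
    by rewrite !mul0r big1 ?mulr0 // => k _; rewrite !mul0r mulr0.
  have [->|nv1] := eqVneq (nu v) 0.
    by rewrite mulr0 !mul0r big1 ?mulr0 // => k _; rewrite !mul0r mulr0.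
  have uA := supp _ nu1; have vA := supp _ nv1.
  set k0 := lev _; have nn : 0 <= nu u * nu v by rewrite mulr_ge0.
  apply: le_trans (ler_wpM2l nn (hkern _)) _; rewrite -/k0 mulrCA ler_wpM2l //.
  rewrite big_mkcond (bigD1_seq k0) ?mem_index_iota ?iota_uniq ?ltnS ?lev_n //=.
  rewrite /ok hG // leqnn mulr1 mulrC lerDl; apply: sumr_ge0 => k _.
  by case: ifP => // _; rewrite !mulr_ge0 ?exprn_ge0 ?(ltW rho0).
apply: (@le_trans _ _ (p ^+ m * (D * \sum_(0 <= k < n.+1 | ok k)
    rho ^+ k * \sum_u \sum_v nu u * nu v * (lev (sigma u - sigma v) <= k)%N%:R))).
  rewrite ler_wpM2l ?exprn_ge0 ?(ltW p_gt0) //.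
  apply: le_trans (ler_sum _ _) _.
    by move=> u _; apply: ler_sum => v _; exact: pw.
  under eq_bigr => u _ do rewrite -mulr_sumr.
  rewrite -mulr_sumr ler_wpM2l // le_eqVlt; apply/orP; left; apply/eqP.
  under eq_bigr => u _ do rewrite exchange_big.
  rewrite exchange_big; apply: eq_bigr => k _; rewrite mulr_sumr.
  by apply: eq_bigr => u _; rewrite mulr_sumr.
rewrite [leLHS]mulrCA -!mulrA ler_wpM2l // mulrA mulr_sumr /pair_form mulr_sumr.
rewrite big_mkcond; apply: ler_sum => k _.
have ov0 : 0 <= overlap k nu nu.
  by apply: sumr_ge0 => u _; apply: sumr_ge0 => v _; rewrite !mulr_ge0.
case: ifP => [okk|_]; last first.
  by rewrite !mulr_ge0 ?exprn_ge0 ?(ltW p_gt0) ?(ltW q_gt0).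
rewrite [leLHS]mulrA; apply: le_trans (ler_wpM2l _ (overlap_near k nu0)) _.
  by rewrite mulr_ge0 ?exprn_ge0 ?(ltW p_gt0) ?(ltW rho0).
rewrite natrM !natrX [leLHS]mulrA [leRHS]mulrA ler_wpM2r //.
have -> : p ^+ m * rho ^+ k * (5 ^+ d * 2 ^+ d ^+ (m - k)) =
    5 ^+ d * kappa k * (2 ^+ d * p) ^+ maxn m k.
  rewrite /rho /kappa !exprMn; case: (leqP k m) => km.
    have -> : 2 ^+ d ^+ m = 2 ^+ d ^+ k * 2 ^+ d ^+ (m - k) :> R by rewrite -exprD subnKC.
    move: (p ^+ m) (p ^+ k) (q ^+ k) (2 ^+ d ^+ k) (2 ^+ d ^+ (m - k)) (5 ^+ d).
    by move=> *; ring.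
  have -> : (m - k = 0)%N by lia.
  move: (p ^+ m) (p ^+ k) (q ^+ k) (2 ^+ d ^+ k) (5 ^+ d).
  by move=> *; rewrite expr0; ring.
by rewrite mulrAC ler_wpM2r ?ler_wpM2l ?exprn_ge0 ?(ltW (kappa_gt0 _)).
Qed.

(** The test measure is the normalized image under addition of the measure that
    the recursion attaches to the root. *)
Lemma hits_upper (kern : 'rV[int]_d -> R) (D G : R) :
  [set` A] `<=` box n -> 0 <= D -> 0 <= G -> (forall z, 0 <= kern z) ->
  (forall z, kern z <= D * (2 ^+ d * (p * q)) ^+ lev z) ->
  (forall x y, x \in A -> y \in A -> (2 ^+ d * p) ^+ maxn m (lev (x - y)) <= G) ->
  0 < coin_prob (hits m n A) ->
  exists2 mu, prob_on A mu &
  coin_prob (hits m n A) * \sum_(x <- A) \sum_(y <- A) mu x * mu y * kern (x - y) <=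
  D * 5 ^+ d * G * energy_cst * q ^+ n.
Proof.
move=> Abox D0 G0 kern0 hkern hG hpos.
pose u0 : pair := ([tuple of nseq m [ffun=> false]], [tuple of nseq n [ffun=> false]]).
have [nu [nu0 supp m1 hE hB]] := admissible_node u0 (leqnn n).
have g_ge : coin_prob (hits m n A) <= mass nu.
  apply: le_trans hE; apply: le_expect => [|o]; first exact: coin_wt01.
  rewrite ler_nat; case: (boolP (hits m n A o)) => // h.
  by have -> := hits_survives u0 h.
have g0 : 0 < mass nu := lt_le_trans hpos g_ge.
have suppA u : nu u != 0 -> sigma u \in A by move=> /supp /andP[].
pose mu z := (\sum_(u | sigma u == z) nu u) / mass nu.
have massE : \sum_(z <- A) \sum_(u | sigma u == z) nu u = mass nu.
  rewrite -(sum_fiber A (fun _ u => nu u)) /mass big_mkcond; apply: eq_bigr => u _.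
  by case: ifPn => // uA; apply/eqP; rewrite eq_sym; apply: contraNT uA => /suppA.
have mu0 x : 0 <= mu x by rewrite divr_ge0 ?(ltW g0) ?sumr_ge0.
exists mu.
  by split => //; rewrite -mulr_suml massE divff ?gt_eqF.
set EE := \sum_(x <- A) _.
have EE0 : 0 <= EE.
  by apply: sumr_ge0 => x _; apply: sumr_ge0 => y _; do 2 apply: mulr_ge0 => //.
have fib f : \sum_u nu u * f (sigma u) = \sum_(x <- A) mass nu * mu x * f x.
  rewrite (eq_bigr (fun x => \sum_(u | sigma u == x) nu u * f x)); last first.
    by move=> x _; rewrite -mulr_suml /mu [mass nu * _]mulrC divfK ?gt_eqF.
  rewrite -(sum_fiber A (fun x u => nu u * f x)) [RHS]big_mkcond; apply: eq_bigr => u _.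
  case: ifPn => // uA; have [->|/suppA] := eqVneq (nu u) 0; first by rewrite mul0r.
  by rewrite (negbTE uA).
have EEq : mass nu ^+ 2 * EE = \sum_u \sum_v nu u * nu v * kern (sigma u - sigma v).
  pose F x := \sum_(y <- A) mass nu * mu y * kern (x - y).
  rewrite (eq_bigr (fun u => nu u * F (sigma u))) => [|u _]; last first.
    rewrite /F -(fib (fun y => kern (sigma u - y))) mulr_sumr.
    by apply: eq_bigr => v _; rewrite mulrA.
  rewrite fib mulr_sumr; apply: eq_bigr => x _; rewrite /F !mulr_sumr.
  by apply: eq_bigr => y _; ring.
have := energy_form nu0 suppA Abox D0 G0 hkern hG; rewrite -EEq => H1.
have DG : 0 <= D * 5 ^+ d * G by rewrite !mulr_ge0 ?exprn_ge0.
have H2 := le_trans H1 (ler_wpM2l DG hB).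
have kn : kappa n = p ^+ m * q ^+ n by rewrite /kappa (minn_idPr mn).
rewrite kn in H2; have pm : 0 < p ^+ m by rewrite exprn_gt0.
apply: le_trans (ler_wpM2r EE0 g_ge) _.
rewrite -(ler_pM2l pm) -(ler_pM2r g0).
move: H2; rewrite expr2; move: (q ^+ n) (p ^+ m) (5 ^+ d) => x y z.
set lhs := (X in X <= _ -> _); set rhs := (X in _ <= X -> _) => H2.
have -> : y * (mass nu * EE) * mass nu = lhs by rewrite /lhs; ring.
by have -> : y * (D * z * G * energy_cst * x) * mass nu = rhs by rewrite /rhs; ring.
Qed.

End Upper.

(** * The Riesz kernel in dyadic form *)

Section Kernel.
Variables (R : realType) (d : nat) (beta : R).
Hypotheses (d_gt0 : (0 < d)%N) (beta_gt0 : 0 < beta).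
Let rho : R := 2 `^ (- beta).

Definition riesz (z : 'rV[int]_d) : R := Num.max (enorm R z) 1 `^ (- beta).

Lemma powRN_anti (a b : R) : 0 < a -> a <= b -> b `^ (- beta) <= a `^ (- beta).
Proof.
move=> a0 ab; have b0 := lt_le_trans a0 ab.
rewrite !powRN lef_pV2 ?posrE ?powR_gt0 //.
by apply: ge0_ler_powR => //; rewrite ?nnegrE ltW.
Qed.

Lemma powRN_pow2 k : (2 ^+ k) `^ (- beta) = rho ^+ k.
Proof.
by rewrite -[2 ^+ k]powR_mulrn // -powRrM mulrC powRrM powR_mulrn ?powR_ge0.
Qed.

Lemma rho_gt0 : 0 < rho. Proof. exact: powR_gt0. Qed.

Lemma rho_lt1 : rho < 1.
Proof. rewrite /rho powRN invf_lt1 ?powR_gt0 // /powR pnatr_eq0 /= expR_gt1.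
by rewrite mulr_gt0 // ln_gt0 // ltr1n. Qed.

Lemma enorm_le_lev (z : 'rV[int]_d) : enorm R z <= d%:R * 2 ^+ lev z.
Proof.
rewrite -[leRHS]ger0_norm ?mulr_ge0 ?exprn_ge0 // -sqrtr_sqr ler_wsqrtr //.
apply: (@le_trans _ _ (\sum_(i < d) (2 ^+ lev z) ^+ 2)).
  apply: ler_sum => i _; rewrite -[leLHS]real_normK ?num_real //.
  rewrite ler_pXn2r ?nnegrE ?exprn_ge0 // -intr_norm -natrX ltW //.
  by rewrite -abszE -pmulrn ltr_nat lev_bound.
rewrite sumr_const card_ord -[leLHS]mulr_natl exprMn ler_wpM2r ?sqr_ge0 //.
by rewrite expr2 ler_peMr ?ler0n // ler1n.
Qed.

Lemma lev_le_enorm (z : 'rV[int]_d) : 2 ^+ (lev z).-1 <= Num.max (enorm R z) 1.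
Proof.
rewrite le_max; case lz : (lev z) => [|k] /=; first by rewrite expr0 lexx orbT.
have : ~~ (lev z <= k)%N by rewrite lz ltnn.
rewrite lev_le negb_forall => /existsP[i]; rewrite -leqNgt => ki.
apply/orP; left; rewrite /enorm.
rewrite -[leLHS]ger0_norm ?exprn_ge0 // -sqrtr_sqr ler_wsqrtr //.
rewrite (bigD1 i) //= -[leLHS]addr0 lerD ?sumr_ge0 //; last by move=> j _; rewrite sqr_ge0.
rewrite -[leRHS]real_normK ?num_real // ler_pXn2r ?nnegrE ?exprn_ge0 //.
by rewrite -intr_norm -natrX -abszE -pmulrn ler_nat.
Qed.

Lemma riesz_ge0 z : 0 <= riesz z. Proof. exact: powR_ge0. Qed.

(** The factor [d ^ beta] compensates for the comparison of the Euclidean and the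
    sup norm. *)
Lemma lev_le_riesz z : rho ^+ lev z <= d%:R `^ beta * riesz z.
Proof.
have d0 : 0 < d%:R :> R by rewrite ltr0n.
rewrite mulrC -ler_pdivrMr ?powR_gt0 // -powRN -powRN_pow2 mulrC.
rewrite -powRM ?exprn_ge0 ?(ltW d0) //; apply: powRN_anti.
  by rewrite lt_max ltr01 orbT.
rewrite ge_max enorm_le_lev -[leLHS]mulr1 ler_pM ?ler1n //.
by rewrite exprn_ege1 // ler1n.
Qed.

Lemma riesz_le_lev z : riesz z <= rho^-1 * rho ^+ lev z.
Proof.
apply: (@le_trans _ _ (rho ^+ (lev z).-1)).
  by rewrite -powRN_pow2; apply: powRN_anti (lev_le_enorm z); rewrite exprn_gt0.
case: (lev z) => [|k] /=; last by rewrite exprS mulKf // gt_eqF ?rho_gt0.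
by rewrite expr0 mulr1 invf_ge1 ?rho_gt0 // ltW ?rho_lt1.
Qed.

End Kernel.

Lemma le_bigmax_mem (R : realDomainType) (I : eqType) (s : seq I) (F : I -> R) i :
  i \in s -> F i <= \big[Num.max/0]_(j <- s) F j.
Proof.
elim: s => // j s IH; rewrite inE big_cons le_max => /predU1P[->|/IH ->].
  by rewrite lexx.
by rewrite orbT.
Qed.

Lemma enorm_le_diam (R : realType) d (A : {fset 'rV[int]_d}) x y :
  x \in A -> y \in A -> enorm R (x - y) <= diam R A.
Proof.
move=> xA yA; apply: le_trans (le_bigmax_mem _ xA).
exact: (le_bigmax_mem (fun y => enorm R (x - y)) yA).
Qed.

(** The case distinction covers a diameter 0 (where [log2e] is infinite) and
    differences of level at most 1, for which the summand 1 suffices. *)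
Lemma lev_le_diam (R : realType) d (A : {fset 'rV[int]_d}) m x y :
  x \in A -> y \in A ->
  (maxn m (lev (x - y)))%:R <=
    fine (maxe (m%:R%:E : \bar R) (log2e (diam R A))) + 1.
Proof.
move=> xA yA; set t := fine _.
have [tm tl] : m%:R <= t /\ (0 < diam R A -> log2 (diam R A) <= t).
  rewrite /t /log2e; case: eqVneq => [->|_].
    by rewrite maxeNy; split => //; rewrite ltxx.
  by rewrite -EFin_max /= !le_max !lexx orbT.
have t0 : 0 <= t by apply: le_trans tm.
rewrite /maxn; case: ifP => _; last by rewrite (le_trans tm) // lerDl.
apply: (@le_trans _ _ ((lev (x - y)).-1.+1)%:R); first by rewrite ler_nat leqSpred.
rewrite -natr1 lerD2r; set k := _.-1.
have := lev_le_enorm R (x - y); rewrite -/k le_max => /orP[]; last first.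
  case: (k) => [|j]; first by rewrite t0.
  by rewrite leNgt exprn_egt1 // ltr1n.
move=> /le_trans /(_ (enorm_le_diam R xA yA)) kd.
have d0 : 0 < diam R A by apply: lt_le_trans kd; rewrite exprn_gt0.
apply: le_trans (tl d0); rewrite /log2 ler_pdivlMr ?ln_gt0 ?ltr1n //.
by rewrite mulr_natl -lnXn // ler_ln ?posrE ?exprn_gt0.
Qed.

Lemma prob_on_exists (R : realType) d (A : {fset 'rV[int]_d}) : A != fset0 ->
  exists mu : 'rV[int]_d -> R, prob_on A mu.
Proof.
case/fset0Pn => x0 x0A; exists (fun x => (x == x0)%:R); split => [x _|].
  by rewrite ler0n.
rewrite (bigD1_seq x0) ?fset_uniq //= eqxx big1 ?addr0 // => x /negbTE ->.
by [].
Qed.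

Theorem theorem1p5 (R : realType) (d : nat) (p q beta : R) :
  (1 <= d)%N -> 0 < p < 1 -> 0 < q < 1 ->
  beta = - log2 (2 ^+ d * p * q) -> 0 < beta ->
  2 ^- d < p -> 2 ^- d < q ->
  exists c C : R, [/\ 0 < c, c <= C &
    forall (dT : measure_display) (T : measurableType dT)
           (P : probability T R) (keep keep' : address d -> set T),
      percolation_coins P p keep ->
      percolation_coins P q keep' ->
      independent_processes P (Q R keep) (Q R keep') ->
    forall (m n : nat) (A : {fset 'rV[int]_d}),
      (1 <= m)%N -> (m <= n)%N ->
      A != fset0 -> [set` A] `<=` box n ->
      let hit :=
        [set t | sumset (Q R keep m t) (Q R keep' n t) `&` [set` A] !=set0] in
      let ratio := fine (P hit) / (q ^+ n * Cap beta A) in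
      c * (2 ^+ d * p) ^+ m <= ratio
      /\ ratio <= C * (2 ^+ d * p) `^
                    fine (maxe (m%:R%:E) (log2e (diam R A)))].

Proof.
move=> d_gt0 p01 q01 betaE beta_gt0 p_gt q_gt.
have [p_gt0 _] := andP p01; have [q_gt0 q_lt1] := andP q01.
have p1 : 1 < 2 ^+ d * p by rewrite -ltr_pdivrMl ?exprn_gt0 // mulr1.
have q1 : 1 < 2 ^+ d * q by rewrite -ltr_pdivrMl ?exprn_gt0 // mulr1.
have rho_pos : 0 < 2 ^+ d * (p * q) by rewrite !mulr_gt0 ?exprn_gt0.
have rhoE : 2 `^ (- beta) = 2 ^+ d * (p * q).
  rewrite betaE opprK /powR pnatr_eq0 /= /log2 divfK ?gt_eqF ?ln_gt0 ?ltr1n //.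
  by rewrite -mulrA lnK.
have rho1 : 2 ^+ d * (p * q) < 1 by rewrite -rhoE rho_lt1.
pose K := 4 ^+ d * convolution_cst d p q * d%:R `^ beta.
have K0 : 0 < K.
  by rewrite !mulr_gt0 ?exprn_gt0 ?convolution_cst_gt0 ?powR_gt0 ?ltr0n.
(* The factor [2 ^+ d * p] is the price of rounding [log2 (diam A)] to a level. *)
pose M := (2 ^+ d * (p * q))^-1 * 5 ^+ d * (2 ^+ d * p) * energy_cst q.
exists K^-1, (Num.max K^-1 M); split; [by rewrite invr_gt0 | by rewrite le_max lexx |].
move=> dT T P keep keep' hk hk' ind m n A m_gt0 mn An0 Abox hit ratio.
have mn' : (0 < m <= n)%N by rewrite m_gt0.
pose Pr := coin_prob p q n (hits m n A).
have PrE : fine (P hit) = Pr by rewrite /hit (hit_law A hk hk' ind mn').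
have Pr0 : 0 <= Pr by apply: expect_ge0 => [c|o]; [exact: coin_wt01|rewrite ler0n].
set I := inf [set energy beta A mu | mu in prob_on A].
have ratioE : ratio = Pr * I / q ^+ n.
  by rewrite /ratio PrE /Cap -/I invfM invrK mulrA mulrAC.
have qn0 : 0 < q ^+ n by rewrite exprn_gt0.
have pm0 : 0 < (2 ^+ d * p) ^+ m by rewrite exprn_gt0 // mulr_gt0 ?exprn_gt0.
have [mu0 hmu0] := prob_on_exists R An0.
have E0 mu : prob_on A mu -> 0 <= energy beta A mu.
  move=> [mu_ge0 _]; rewrite /energy big_seq; apply: sumr_ge0 => x xA.
  rewrite big_seq; apply: sumr_ge0 => y yA.
  by rewrite mulr_ge0 ?powR_ge0 // mulr_ge0 ?mu_ge0.
(* The lower bound holds for every test measure, hence for the infimum; it also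
   shows that the hitting probability does not vanish. *)
have low mu : prob_on A mu ->
    (2 ^+ d * p) ^+ m * q ^+ n <= K * (Pr * energy beta A mu).
  move=> hmu.
  have := @hits_lower R d p q m n p01 q01 m_gt0 mn A mu (riesz beta) (d%:R `^ beta).
  have Dge : 0 <= d%:R `^ beta :> R := powR_ge0 _ _.
  by apply=> // z; rewrite -rhoE; apply: lev_le_riesz.
have Prpos : 0 < Pr.
  rewrite lt_neqAle Pr0 andbT; apply/negP => /eqP z.
  by have := low _ hmu0; rewrite -z mul0r mulr0 leNgt mulr_gt0.
split.
  rewrite ratioE ler_pdivlMr // -mulrA ler_pdivrMl //.
  rewrite -ler_pdivrMl // -ler_pdivrMl //.
  apply: lb_le_inf; first by exists (energy beta A mu0), mu0.
  by move=> _ [mu hmu <-]; rewrite ler_pdivrMl // ler_pdivrMl // low.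
set t := fine _.
pose G := (2 ^+ d * p) * (2 ^+ d * p) `^ t.
have P1 : 0 < 2 ^+ d * p by rewrite (lt_trans ltr01).
have G0 : 0 <= G by rewrite mulr_ge0 ?powR_ge0 ?(ltW P1).
have [|||||||mu hmu up] :=
  @hits_upper R d p q m n p01 q01 m_gt0 mn A (riesz beta) (2 ^+ d * (p * q))^-1 G.
- by [].
- by rewrite invr_ge0 ltW.
- by [].
- exact: riesz_ge0.
- by move=> z; rewrite -rhoE; apply: riesz_le_lev.
- move=> x y xA yA; have -> : G = (2 ^+ d * p) `^ (t + 1).
    have Pne : 2 ^+ d * p != 0 by rewrite gt_eqF.
    by rewrite powRD ?Pne ?implybT // powRr1 ?(ltW P1) // mulrC.
  rewrite -powR_mulrn ?(ltW P1) // ler_powR ?(ltW p1) //.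
  exact: lev_le_diam.
- exact: Prpos.
rewrite ratioE ler_pdivrMr //.
apply: (@le_trans _ _ (Pr * energy beta A mu)).
  rewrite ler_wpM2l //; apply: ge_inf; last by exists mu.
  by exists 0 => _ [nu hnu <-]; apply: E0.
apply: le_trans up _; apply: (@le_trans _ _ (M * (2 ^+ d * p) `^ t * q ^+ n)).
  by rewrite le_eqVlt; apply/orP; left; apply/eqP; rewrite /G /M; ring.
by rewrite ler_wpM2r ?(ltW qn0) // ler_wpM2r ?powR_ge0 // le_max lexx orbT.
Qed.
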